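(* Let $\Omega\subset\mathbb{R}^n$ be open and bounded, $F\in C^0\big(\mathbb{R}\times\mathbb{R}^n\times\mathbb{S}(n)\big)$ and $f,b\in C^0(\overline{\Omega})$. Assume that for all $r,s\in\mathbb{R}$, $p\in\mathbb{R}^n$, $X,Y\in\mathbb{S}(n)$, $$X\le Y\ \Longrightarrow\ F(r,p,X)\le F(r,p,Y),$$ $$r\le s\ \Longrightarrow\ F(r,p,X)\ge F(s,p,X)+\gamma(s-r),$$ for some constant $\gamma>0$. Then the boundary value problem $$F(u,Du,D^2u)=f\ \text{ in }\Omega,\qquad u=b\ \text{ on }\partial\Omega,$$ admits at most one viscosity solution $u\in C^0(\overline{\Omega})$.
   Context: $\mathbb{S}(n)$ is the space of real symmetric $n\times n$ matrices, ordered by: $X\le Y$ iff $Y-X$ is positive semidefinite; $X:z\otimes z=\sum_{i,j}X_{ij}z_iz_j$. For $u:\Omega\to\mathbb{R}$ and $x\in\Omega$, $\mathcal{J}^{2,+}u(x)$ is the set of all $(p,X)\in\mathbb{R}^n\times\mathbb{S}(n)$ such that $u(x+z)\le u(x)+p\cdot z+\frac12X:z\otimes z+o(|z|^2)$ as $z\to0$; $\mathcal{J}^{2,-}u(x)$ is defined in the same way with $\le$ replaced by $\ge$. A viscosity solution of the boundary value problem is a function $u\in C^0(\overline{\Omega})$ with $u=b$ pointwise on $\partial\Omega$ such that for all $x\in\Omega$: $F(u(x),p,X)\ge f(x)$ for every $(p,X)\in\mathcal{J}^{2,+}u(x)$, and $F(u(x),p,X)\le f(x)$ for every $(p,X)\in\mathcal{J}^{2,-}u(x)$.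 *)

(* Defs.v *)
From HB Require Import structures.
From mathcomp Require Import all_boot all_order all_algebra.
From mathcomp Require Import all_classical all_reals all_analysis.

Set Implicit Arguments.
Unset Strict Implicit.
Unset Printing Implicit Defensive.

Import Order.TTheory GRing.Theory Num.Theory.
Import numFieldNormedType.Exports.

Local Open Scope classical_set_scope.
Local Open Scope ring_scope.

(* Vectors of R^n are row vectors.  The library norm on 'rV[R]_n is the sup
   norm, so the Euclidean |z|^2 is written [dotv z z]. *)
Definition dotv (R : realType) (n : nat) (p z : 'rV[R]_n) : R :=
  \sum_(i < n) p 0 i * z 0 i.

(* X : z (x) z *)
Definition quadv (R : realType) (n : nat) (X : 'M[R]_n) (z : 'rV[R]_n) : R :=
  \sum_(i < n) \sum_(j < n) X i j * z 0 i * z 0 j.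

Definition symm (R : realType) (n : nat) : set 'M[R]_n :=
  [set X | X \is symmetricmx].

(* Order on symmetric matrices: Y - X is positive semidefinite. *)
Definition le_symm (R : realType) (n : nat) (X Y : 'M[R]_n) : Prop :=
  forall z : 'rV[R]_n, 0 <= quadv (Y - X) z.

(* The function u is total, but at a point x of an open set Omega the jets
   depend only on the restriction of u to Omega. *)
Definition superjet (R : realType) (n : nat) (u : 'rV[R]_n -> R)
    (x : 'rV[R]_n) : set ('rV[R]_n * 'M[R]_n) :=
  [set pX | symm pX.2 /\
    exists2 rho : 'rV[R]_n -> R,
      rho =o_ (0 : 'rV[R]_n) (fun z => dotv z z) &
      \forall z \near (0 : 'rV[R]_n),
        u (x + z) <= u x + dotv pX.1 z + 2^-1 * quadv pX.2 z + rho z].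

Definition subjet (R : realType) (n : nat) (u : 'rV[R]_n -> R)
    (x : 'rV[R]_n) : set ('rV[R]_n * 'M[R]_n) :=
  [set pX | symm pX.2 /\
    exists2 rho : 'rV[R]_n -> R,
      rho =o_ (0 : 'rV[R]_n) (fun z => dotv z z) &
      \forall z \near (0 : 'rV[R]_n),
        u (x + z) >= u x + dotv pX.1 z + 2^-1 * quadv pX.2 z + rho z].

(* F stands for a function on R * R^n * S(n): it is total in its matrix
   argument, but only its values at symmetric matrices are ever used. *)
Definition continuous_operator (R : realType) (n : nat)
    (F : R -> 'rV[R]_n -> 'M[R]_n -> R) : Prop :=
  {within [set t : R * 'rV[R]_n * 'M[R]_n | symm t.2],
    continuous (fun t : R * 'rV[R]_n * 'M[R]_n => F t.1.1 t.1.2 t.2)}.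

(* The sign convention is that of F nondecreasing in its matrix argument:
   F >= f on superjets and F <= f on subjets. *)
Definition viscosity_solution (R : realType) (n : nat) (Omega : set 'rV[R]_n)
    (F : R -> 'rV[R]_n -> 'M[R]_n -> R) (f b u : 'rV[R]_n -> R) : Prop :=
  [/\ {within closure Omega, continuous u},
      (forall x, (closure Omega `\` interior Omega) x -> u x = b x),
      (forall x, Omega x -> forall p X,
         superjet u x (p, X) -> F (u x) p X >= f x) &
      (forall x, Omega x -> forall p X,
         subjet u x (p, X) -> F (u x) p X <= f x)].

(* Main.v *)
Require Import Defs.
From mathcomp Require Import all_boot all_order all_algebra.
From mathcomp Require Import all_classical all_reals all_analysis.
From mathcomp Require Import zify ring lra.

Import Order.TTheory GRing.Theory Num.Theory.
Import numFieldNormedType.Exports.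

Local Open Scope classical_set_scope.
Local Open Scope ring_scope.

(** If two solutions [u] and [v] satisfy [M = u x0 - v x0 > 0], replace [u] and [- v]
by their sup-convolutions [fu] and [fv], which are semiconvex with constant [L] and whose
superjets are superjets of [u] and [- v] at nearby points. At a maximum point of
[fu + fv] one wants superjets [(p, A)] of [fu] and [(- p, B)] of [fv], possibly as limits,
with [A + B <= 0]: this is [limiting_jets]. For large [L] the corresponding points
[y] and [z] lie in [Omega], close to each other; ellipticity and properness give
[gamma * M <= f z - f y] for the right-hand side [f] of the equation, which
contradicts its uniform continuity ([viscosity_comparison]).

The usual way to these superjets is through Alexandrov's theorem and Jensen's lemma. The
proof below replaces them by a counting argument and a strong maximum principle. Let [f]
and [g] be semiconvex functions such that [f + g] is maximal somewhere, even after the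
subtraction of a small linear function.

Consider the points where [f + g] touches from below an affine function of small
slope. Semiconvexity squeezes both functions between paraboloids there, so the map from
slopes to contact points is expanding ([contact_expanding]). Counting cubes, a set that
contains the image of a cube under an expanding map fills all the subcubes of some
small cube ([expanding_fills_cube]): otherwise its packing numbers would grow too slowly.
Rescaling around such cubes, a limit of [f] and [g] is a pair of C^{1,1} functions on the
whole space with concave sum.

It remains to find, for such a pair, matrices [A] and [B] that touch the two functions from
above, at any points whatsoever, with [A + B <= d] for a given [d > 0]
([touching_matrices]); they are carried back to the original functions since touching is
stable under limits. Suppose that there are none, and consider all the pairs
with this defect, a class that is stable under zooming in and under limits. Among the
matrices touching the first member of such a pair, choose one of least trace. After
another blow-up this member lies below its touching quadratic form, which it meets
at the origin, and it is a viscosity subsolution of the Poisson equation solved by the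
form. By the strong maximum principle it is equal to the form ([blowup_quadratic]). Do the same
for the second member. The result is a pair of quadratic polynomials with the defect; but
their sum is concave, and each polynomial is touched by itself. *)

(** * Euclidean vectors and quadratic forms *)

Section Euclid.
Context {R : realType} {n : nat}.
Implicit Types (p z w h : 'rV[R]_n) (X Y : 'M[R]_n) (a c : R).

Definition sq z : R := dotv z z.

Lemma dotvC p z : dotv p z = dotv z p.
Proof. by apply: eq_bigr => i _; rewrite mulrC. Qed.

Lemma dotvDl p w z : dotv (p + w) z = dotv p z + dotv w z.
Proof. by rewrite -big_split; apply: eq_bigr => i _; rewrite mxE mulrDl. Qed.

Lemma dotvZl a p z : dotv (a *: p) z = a * dotv p z.
Proof. by rewrite mulr_sumr; apply: eq_bigr => i _; rewrite mxE mulrA. Qed.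

Lemma dotvNl p z : dotv (- p) z = - dotv p z.
Proof. by rewrite -scaleN1r dotvZl mulN1r. Qed.

Lemma dotvDr p w z : dotv p (w + z) = dotv p w + dotv p z.
Proof. by rewrite dotvC dotvDl !(dotvC p). Qed.

Lemma dotvZr a p z : dotv p (a *: z) = a * dotv p z.
Proof. by rewrite dotvC dotvZl dotvC. Qed.

Lemma dotvNr p z : dotv p (- z) = - dotv p z.
Proof. by rewrite dotvC dotvNl dotvC. Qed.

Lemma dotv0l z : dotv 0 z = 0.
Proof. by rewrite -(scale0r 0) dotvZl mul0r. Qed.

Lemma dotv0r z : dotv z 0 = 0.
Proof. by rewrite dotvC dotv0l. Qed.

Definition dotvE := (dotvDl, dotvDr, dotvNl, dotvNr, dotvZl, dotvZr,
  dotv0l, dotv0r).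

Lemma sq_ge0 z : 0 <= sq z.
Proof. by apply: sumr_ge0 => i _; rewrite -expr2 sqr_ge0. Qed.

Lemma sq_eq0 z : sq z = 0 -> z = 0.
Proof.
move=> z0; apply/rowP => i; rewrite mxE; apply/eqP.
rewrite -sqrf_eq0 expr2; move/eqP: z0; rewrite /sq psumr_eq0; last first.
  by move=> j _; rewrite -expr2 sqr_ge0.
by move=> /allP /(_ i (mem_index_enum i)).
Qed.

Lemma sq_gt0 z : z != 0 -> 0 < sq z.
Proof.
move=> z0; rewrite lt_neqAle sq_ge0 andbT; apply: contra z0 => /eqP z0.
by apply/eqP/sq_eq0.
Qed.

Lemma sqD z w : sq (z + w) = sq z + 2 * dotv z w + sq w.
Proof. by rewrite /sq !dotvE (dotvC w z); ring. Qed.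

Lemma sqN z : sq (- z) = sq z.
Proof. by rewrite /sq !dotvE opprK. Qed.

Lemma sqB z w : sq (z - w) = sq z - 2 * dotv z w + sq w.
Proof. by rewrite sqD sqN dotvNr mulrN. Qed.

Lemma sqZ a z : sq (a *: z) = a ^+ 2 * sq z.
Proof. by rewrite /sq !dotvE mulrA expr2. Qed.

Lemma sq0 : sq 0 = 0.
Proof. exact: dotv0l. Qed.

Lemma sqBC z w : sq (z - w) = sq (w - z).
Proof. by rewrite -sqN opprB. Qed.

(** Young's inequality; a free weight [c] makes up for the absence of a Euclidean
norm, since only squared lengths [sq] occur. *)
Lemma dotv_young c p z : 0 < c -> 2 * dotv p z <= c * sq p + c^-1 * sq z.
Proof.
move=> c0; have := sq_ge0 (c *: p - z); rewrite sqB sqZ dotvZl => H.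
rewrite -(ler_pM2l c0) mulrDr !mulrA divff ?gt_eqF// mul1r; lra.
Qed.

Lemma sqD_le z w : sq (z + w) <= 2 * sq z + 2 * sq w.
Proof. by have := sq_ge0 (z - w); rewrite sqB sqD; lra. Qed.

Lemma sum_const_ord c : \sum_(i < n) c = n%:R * c.
Proof. by rewrite sumr_const card_ord mulr_natl. Qed.

Lemma norm_coord_le z i : `|z 0 i| <= `|z|.
Proof. by rewrite [`|z|]mx_normrE; apply: (le_bigmax _ _ (0, i)). Qed.

Lemma norm_le_coord z c : 0 <= c -> (forall i, `|z 0 i| <= c) -> `|z| <= c.
Proof.
move=> c0 H; rewrite [`|z|]mx_normrE; apply/bigmax_leP; split => // -[i j] _ /=.
by rewrite (ord1 i).
Qed.

Lemma coord_sq_le z i : (z 0 i) ^+ 2 <= sq z.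
Proof.
rewrite /sq /dotv (bigD1 i)//= -expr2 lerDl.
by apply: sumr_ge0 => j _; rewrite -expr2 sqr_ge0.
Qed.

Lemma norm_sq_le z : `|z| ^+ 2 <= sq z.
Proof.
have [z0|z0] := eqVneq z 0; first by rewrite z0 normr0 expr0n/= sq0.
have [[i j] /= E] := mx_norm_neq0 (x := z) (contra_not_neq (@mx_norm_eq0 _ _ _ z) (elimN eqP z0)).
by rewrite [`|z|]E (ord1 i) real_normK ?num_real// coord_sq_le.
Qed.

Lemma sq_le_norm z : sq z <= n%:R * `|z| ^+ 2.
Proof.
rewrite -sum_const_ord; apply: ler_sum => i _.
by rewrite -expr2 -real_normK ?num_real// lerXn2r ?nnegrE// norm_coord_le.
Qed.

Lemma quadvE X z : quadv X z = dotv (z *m X) z.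
Proof.
rewrite /quadv exchange_big; apply: eq_bigr => j _; rewrite mxE mulr_suml.
by apply: eq_bigr => i _; rewrite (mulrC (X i j)).
Qed.

Lemma quadvDl X Y z : quadv (X + Y) z = quadv X z + quadv Y z.
Proof. by rewrite !quadvE mulmxDr dotvDl. Qed.

Lemma quadvNl X z : quadv (- X) z = - quadv X z.
Proof. by rewrite !quadvE mulmxN dotvNl. Qed.

Lemma quadvZl a X z : quadv (a *: X) z = a * quadv X z.
Proof. by rewrite !quadvE -scalemxAr dotvZl. Qed.

Lemma quadv_scalar a z : quadv a%:M z = a * sq z.
Proof. by rewrite quadvE mul_mx_scalar dotvZl. Qed.

Lemma quadv_sqr p z : quadv (p^T *m p) z = dotv p z ^+ 2.
Proof.
rewrite quadvE mulmxA; have -> : z *m p^T = (dotv p z)%:M.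
  apply/matrixP => i j; rewrite !mxE !ord1 eqxx mulr1n.
  by apply: eq_bigr => k _; rewrite mxE mulrC.
by rewrite mul_scalar_mx dotvZl expr2.
Qed.

Lemma quadvZr X a z : quadv X (a *: z) = a ^+ 2 * quadv X z.
Proof. by rewrite !quadvE -scalemxAl !dotvE mulrA expr2. Qed.

Lemma quadv0r X : quadv X 0 = 0.
Proof. by rewrite quadvE dotv0r. Qed.

Lemma quadvN X z : quadv X (- z) = quadv X z.
Proof. by rewrite -scaleN1r quadvZr; ring. Qed.

Lemma symmP X : symm X <-> X^T = X.
Proof.
split=> [|XT]; first by rewrite /symm /= qualifE/= => /eqP {2}->; rewrite expr0 scale1r map_mx_id.
by rewrite /symm /= qualifE/= expr0 scale1r map_mx_id// XT.
Qed.

Lemma dotv_mulmx X z w : symm X -> dotv (z *m X) w = dotv z (w *m X).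
Proof.
move=> /symmP XT.
transitivity (\tr ((z *m X) *m w^T)).
  by rewrite /mxtrace big_ord1 !mxE; apply: eq_bigr => k _; rewrite !mxE.
transitivity (\tr (z *m (w *m X)^T)).
  by rewrite trmx_mul XT mulmxA.
by rewrite /mxtrace big_ord1 !mxE; apply: eq_bigr => k _; rewrite !mxE.
Qed.

Lemma quadvD X z h : symm X ->
  quadv X (z + h) = quadv X z + 2 * dotv (z *m X) h + quadv X h.
Proof.
move=> sX; rewrite !quadvE mulmxDl !dotvE.
have -> : dotv (h *m X) z = dotv (z *m X) h by rewrite dotv_mulmx// dotvC.
by ring.
Qed.

Lemma le_symmP X Y : le_symm X Y <-> forall z, quadv X z <= quadv Y z.
Proof.
by split=> H z; have := H z; rewrite quadvDl quadvNl subr_ge0.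
Qed.

Lemma symmD X Y : symm X -> symm Y -> symm (X + Y).
Proof. by move=> /symmP X1 /symmP Y1; apply/symmP; rewrite linearD/= X1 Y1. Qed.

Lemma symmN X : symm X -> symm (- X).
Proof. by move=> /symmP X1; apply/symmP; rewrite linearN/= X1. Qed.

Lemma symmZ a X : symm X -> symm (a *: X).
Proof. by move=> /symmP X1; apply/symmP; rewrite linearZ/= X1. Qed.

Lemma symm_scalar a : symm (a%:M : 'M[R]_n).
Proof. by apply/symmP; rewrite tr_scalar_mx. Qed.

Lemma symm_sqr p : symm (p^T *m p).
Proof. by apply/symmP; rewrite trmx_mul trmxK. Qed.

Lemma trace_sqr p : \tr (p^T *m p) = sq p.
Proof.
rewrite mxtrace_mulC /mxtrace big_ord1 !mxE; apply: eq_bigr => i _.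
by rewrite mxE.
Qed.

Lemma delta_mulmx X i j : ((delta_mx 0 i : 'rV_n) *m X) 0 j = X i j.
Proof. by rewrite -rowE mxE. Qed.

Lemma dotv_delta p i : dotv p (delta_mx 0 i) = p 0 i.
Proof.
rewrite /dotv (bigD1 i)//= mxE !eqxx mulr1 big1 ?addr0// => j ji.
by rewrite mxE eqxx (negbTE ji) mulr0.
Qed.

Lemma quadv_delta X i : quadv X (delta_mx 0 i) = X i i.
Proof. by rewrite quadvE dotv_delta delta_mulmx. Qed.

Lemma sq_delta i : sq (delta_mx 0 i) = 1.
Proof. by rewrite /sq dotv_delta mxE !eqxx. Qed.

(** Polarization: [X i j] is a combination of the values of the form at the
vectors [e_i], [e_j] and [e_i + e_j]. *)
Lemma entry_bound X c : symm X -> 0 <= c ->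
  (forall z, `|quadv X z| <= c * sq z) -> forall i j, `|X i j| <= 3 * c.
Proof.
move=> sX c0 H i j.
have := H (delta_mx 0 i + delta_mx 0 j).
have := H (delta_mx 0 i); have := H (delta_mx 0 j).
have := sqD_le (delta_mx 0 i) (delta_mx 0 j).
rewrite (quadvD _ _ _ sX) dotv_delta delta_mulmx !sq_delta !quadv_delta.
set s := sq _ => s4; rewrite !ler_norml => /andP[? ?] /andP[? ?] /andP[a1 a2].
have : c * s <= c * 4 by rewrite ler_wpM2l//; lra.
by move=> ?; apply/andP; split; lra.
Qed.

Lemma trace_ge X c : (forall z, - c * sq z <= quadv X z) ->
  - (n%:R * c) <= \tr X.
Proof.
move=> H; rewrite -mulrN -sum_const_ord.
apply: ler_sum => i _.
by have := H (delta_mx 0 i); rewrite sq_delta quadv_delta; lra.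
Qed.

(** A lower bound on the form and an upper bound on the trace bound every
eigenvalue, hence every entry. This gives the compactness of the set of
matrices over which the trace is minimized below. *)
Lemma entry_bound_trace X c t : symm X -> 0 <= c ->
  (forall z, - c * sq z <= quadv X z) -> \tr X <= t ->
  forall i j, `|X i j| <= 3 * (`|t| + n%:R * c + c).
Proof.
move=> sX c0 H Xt.
have diag i : X i i <= `|t| + n%:R * c.
  have := Xt; rewrite /mxtrace (bigD1 i)//= => Xt'.
  have : - (n%:R * c) <= \sum_(j < n | j != i) X j j.
    apply: (@le_trans _ _ (\sum_(j < n | j != i) (- c))).
      rewrite sumr_const mulNrn lerN2 mulr_natl ler_wpMn2l//.
      by rewrite -[leqRHS](card_ord n) max_card.
    apply: ler_sum => j _.
    by have := H (delta_mx 0 j); rewrite sq_delta quadv_delta; lra.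
  by have := ler_norm t; lra.
have lo i : - c <= X i i.
  by have := H (delta_mx 0 i); rewrite sq_delta quadv_delta; lra.
move=> i j; have := diag i; have := diag j.
have := H (delta_mx 0 i + delta_mx 0 j).
have := H (delta_mx 0 i - delta_mx 0 j).
rewrite !(quadvD _ _ _ sX) quadvN dotvNr dotv_delta delta_mulmx !quadv_delta.
have := sqD_le (delta_mx 0 i) (delta_mx 0 j).
have := sqD_le (delta_mx 0 i) (- delta_mx 0 j).
rewrite sqN !sq_delta; set s1 := sq _; set s2 := sq _ => s14 s24.
have : c * s1 <= c * 4 by rewrite ler_wpM2l//; lra.
have : c * s2 <= c * 4 by rewrite ler_wpM2l//; lra.
have := lo i; have := lo j.
have : 0 <= `|t| + n%:R * c by rewrite addr_ge0// mulr_ge0.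
rewrite ler_norml; set N := _ + n%:R * c => *; apply/andP; split; lra.
Qed.

End Euclid.

(** * Limits along filters and ultrafilters *)

Section Limits.
Context {R : realType} {n : nat} {T : Type} (F : set_system T).
Context {FF : Filter F}.

Lemma cvg_entries {m : nat} (A_ : T -> 'M[R]_(m, n)) (A : 'M[R]_(m, n)) :
  (forall i j, A_ k i j @[k --> F] --> A i j) -> A_ @ F --> A.
Proof.
move=> H; apply/cvg_ballP => e e0.
have : \forall k \near F, forall ij : 'I_m * 'I_n,
    ball (A ij.1 ij.2) e (A_ k ij.1 ij.2).
  apply: (@filter_forall _ _ (fun ij k => ball (A ij.1 ij.2) e (A_ k ij.1 ij.2)) F).
  by move=> ij; move/cvg_ballP : (H ij.1 ij.2); exact.
by apply: filterS => k Hk; split => // i j; exact: (Hk (i, j)).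
Qed.

Lemma cvg_entry {m : nat} (A_ : T -> 'M[R]_(m, n)) (A : 'M[R]_(m, n)) i j :
  A_ @ F --> A -> A_ k i j @[k --> F] --> A i j.
Proof.
move=> AA; apply: (@continuous_cvg _ _ _ F _ A_ (fun M : 'M[R]_(m, n) => M i j) A _ AA).
exact: coord_continuous.
Qed.

Lemma cvg_sum_ord (f_ : 'I_n -> T -> R) (f : 'I_n -> R) :
  (forall i, f_ i @ F --> f i) ->
  (\sum_(i < n) f_ i k) @[k --> F] --> \sum_(i < n) f i.
Proof. by move=> H; apply: cvg_big => //; exact: add_continuous. Qed.

Lemma cvg_dotv (p_ z_ : T -> 'rV[R]_n) p z : p_ @ F --> p -> z_ @ F --> z ->
  dotv (p_ k) (z_ k) @[k --> F] --> dotv p z.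
Proof.
by move=> pp zz; apply: cvg_sum_ord => i; apply: cvgM; exact: cvg_entry.
Qed.

Lemma cvg_sq (z_ : T -> 'rV[R]_n) z : z_ @ F --> z ->
  sq (z_ k) @[k --> F] --> sq z.
Proof. by move=> zz; exact: cvg_dotv. Qed.

Lemma cvg_quadv (A_ : T -> 'M[R]_n) (z_ : T -> 'rV[R]_n) A z :
  A_ @ F --> A -> z_ @ F --> z ->
  quadv (A_ k) (z_ k) @[k --> F] --> quadv A z.
Proof.
move=> AA zz; apply: cvg_sum_ord => i; apply: cvg_sum_ord => j.
by apply: cvgM; [apply: cvgM|]; exact: cvg_entry.
Qed.

Lemma cvg_trace (A_ : T -> 'M[R]_n) A :
  A_ @ F --> A -> \tr (A_ k) @[k --> F] --> \tr A.
Proof. by move=> AA; apply: cvg_sum_ord => i; exact: cvg_entry. Qed.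

Lemma cvg_sq0 (z_ : T -> 'rV[R]_n) : sq (z_ k) @[k --> F] --> (0 : R) ->
  z_ @ F --> (0 : 'rV[R]_n).
Proof.
move=> /cvgrPdist_lt H; apply/cvgrPdist_lt => e e0.
have := H (e ^+ 2) (exprn_gt0 _ e0); apply: filterS => k.
rewrite !sub0r !normrN ger0_norm ?sq_ge0// => Hk.
rewrite -(ltr_pXn2r (ltn0Sn 1))// ?nnegrE ?(ltW e0)//.
exact: le_lt_trans (norm_sq_le _) Hk.
Qed.

End Limits.

Lemma symm_limit {R : realType} {n : nat} {T : Type} (F : set_system T)
    {FF : ProperFilter F} (A_ : T -> 'M[R]_n) A :
  (forall k, symm (A_ k)) -> A_ @ F --> A -> symm A.
Proof.
move=> sA AA; apply/symmP/matrixP => i j; rewrite mxE.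
apply: (@cvg_unique _ (@Rhausdorff R) (fmap (fun k => A_ k i j) F)).
  have -> : (fun k => A_ k i j) = (fun k => A_ k j i).
    by apply/funext => k; have /symmP {1}<- := sA k; rewrite mxE.
  exact: cvg_entry.
exact: cvg_entry.
Qed.

Section Ultralimits.
Context {R : realType} {n : nat} (U : set_system nat) {UU : UltraFilter U}.

(** Ultrafilters replace the extraction of subsequences: all limits below are
taken along one ultrafilter, so that no choice of a subsequence has to be made
compatible with another one. *)
Lemma compact_ultralimit {T : topologicalType} (K : set T) (x_ : nat -> T) :
  compact K -> (\forall k \near U, K (x_ k)) -> exists2 l, K l & x_ @ U --> l.
Proof.
move=> cK Kx; have [//|l [Kl cl]] := cK (x_ @ U) _.
exists l => // B Bl.
have [//|UnB] := in_ultra_setVsetC (x_ @^-1` B) UU.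
by have [y [nBy By]] := cl (~` B) B UnB Bl.
Qed.

Lemma bounded_ultralimit (x_ : nat -> R) (c : R) :
  (\forall k \near U, `|x_ k| <= c) -> exists l : R, x_ @ U --> l.
Proof.
move=> xc.
have [|l _ ?] := @compact_ultralimit _ `[- c, c]%classic x_ (@segment_compact R _ _).
  by apply: filterS xc => k /=; rewrite in_itv/= -ler_norml.
by exists l.
Qed.

Lemma bounded_ultralimit_mx m (A_ : nat -> 'M[R]_(m, n)) (c : R) :
  (\forall k \near U, forall i j, `|A_ k i j| <= c) ->
  exists A : 'M[R]_(m, n), A_ @ U --> A.
Proof.
move=> Ac.
have /choice[f Hf] : forall ij : 'I_m * 'I_n,
    exists l : R, A_ k ij.1 ij.2 @[k --> U] --> l.
  by move=> ij; apply: (@bounded_ultralimit _ c); apply: filterS Ac => k; exact.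
exists (\matrix_(i, j) f (i, j)); apply: cvg_entries => i j.
by rewrite mxE; exact: (Hf (i, j)).
Qed.

Lemma bounded_ultralimit_sq (z_ : nat -> 'rV[R]_n) (c : R) :
  (\forall k \near U, sq (z_ k) <= c) -> exists z : 'rV[R]_n, z_ @ U --> z.
Proof.
move=> zc; apply: (@bounded_ultralimit_mx _ _ (c + 1)).
apply: filterS zc => k zc i j.
rewrite (ord1 i); have := le_trans (coord_sq_le (z_ k) j) zc.
set t := z_ k 0 j => tc; rewrite ler_norml.
have := sqr_ge0 (t - 2^-1); have := sqr_ge0 (t + 2^-1).
by rewrite sqrrD sqrrB => ? ?; apply/andP; split; lra.
Qed.

End Ultralimits.

(** * Paraboloids touching from above *)

Section Touching.
Context {R : realType} {n : nat}.
Implicit Types (f : 'rV[R]_n -> R) (p z h : 'rV[R]_n) (A : 'M[R]_n).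

Lemma compact_sq_ball (r : R) : compact [set h : 'rV[R]_n | sq h <= r].
Proof.
apply: bounded_closed_compact.
  exists (`|r| + 1); split; first by rewrite num_real.
  move=> M rM h /= hr; apply: le_trans (ltW rM).
  have := norm_sq_le h; have := ler_norm r; have := normr_ge0 h.
  have := normr_ge0 r.
  by set t := `|h| => *; nra.
apply: (@preimage_closed _ _ (fun h : 'rV[R]_n => sq h) [set x | x <= r]); last exact: closed_le.
by move=> h _; apply: (@cvg_sq _ _ _ (nbhs h) _ id h); exact: cvg_id.
Qed.

(** The pair [(p, A)] is a superjet of [f] at [z] without remainder; [r] bounds the
squared radius of the ball where the inequality holds. *)
Definition touch f z p A := symm A /\ exists2 r, 0 < r &
  forall h, sq h <= r -> f (z + h) <= f z + dotv p h + 2^-1 * quadv A h.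

(** If [f] minus a quadratic polynomial is smaller on a sphere than at its centre,
its maximum over the ball is interior. There the polynomial, translated
vertically, touches [f]. Only the gradient changes with the point of contact,
not the matrix. *)
Lemma interior_touch f z p A (r : R) : continuous f -> symm A -> 0 < r ->
  (forall h, sq h = r -> f (z + h) - (dotv p h + 2^-1 * quadv A h) < f z) ->
  exists h0 p', sq h0 < r /\ touch f (z + h0) p' A.
Proof.
move=> cf sA r0 Hr.
pose g h := f (z + h) - (dotv p h + 2^-1 * quadv A h).
have cg : continuous g.
  move=> h; have hh : id @ nbhs h --> h by exact: cvg_id.
  have FF : Filter (nbhs h) := nbhs_filter h.
  have h1 : (fun k => z + k) @ nbhs h --> z + h by apply: cvgD => //; exact: cvg_cst.
  have h2 := @continuous_cvg _ _ _ (nbhs h) FF _ f _ (cf _) h1.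
  have h3 : (fun k => dotv p k) @ nbhs h --> dotv p h.
    by apply: cvg_dotv => //; exact: cvg_cst.
  have h4 : (fun k => 2^-1 * quadv A k) @ nbhs h --> 2^-1 * quadv A h.
    by apply: cvgM; [exact: cvg_cst|apply: cvg_quadv => //; exact: cvg_cst].
  exact: (cvgB h2 (cvgD h3 h4)).
have [|h0] := @compact_EVT_max _ _ g _ _ (compact_sq_ball r) (continuous_subspaceT cg).
  by exists 0; rewrite /= sq0 ltW.
rewrite inE/= => h0r Hmax.
have g0 : g 0 = f z by rewrite /g addr0 dotv0r quadv0r mulr0 addr0 subr0.
have gh0 : f z <= g h0 by rewrite -g0; apply: Hmax; rewrite inE/= sq0 ltW.
have {}h0r : sq h0 < r.
  rewrite lt_neqAle h0r andbT; apply/eqP => E.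
  by have := Hr _ E; rewrite ltNge gh0.
exists h0, (p + h0 *m A); split => //; split => //.
pose d := r - sq h0; have d0 : 0 < d by rewrite subr_gt0.
pose c := d / (2 * (sq h0 + 1)).
have s0 : 0 < sq h0 + 1 by have := sq_ge0 h0; lra.
have c0 : 0 < c by rewrite divr_gt0// mulr_gt0.
have cE : c * (sq h0 + 1) = d / 2 by rewrite /c; field; rewrite gt_eqF.
have i0 : 0 < 1 + c^-1 by rewrite addr_gt0// invr_gt0.
exists ((d / 2) / (1 + c^-1)) => [|h hr]; first by rewrite !divr_gt0.
move: hr; rewrite ler_pdivlMr// => hr.
have : g (h0 + h) <= g h0.
  apply: Hmax; rewrite inE/= sqD.
  have := dotv_young _ h0 h c0; rewrite /d in cE hr *; lra.
rewrite /g (quadvD _ _ _ sA) !dotvE !addrA; lra.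
Qed.

End Touching.

(** * Functions squeezed between paraboloids *)

Section Slopes.
Context {R : realType} {n : nat} (L : R).
Implicit Types (f g : 'rV[R]_n -> R) (p z h w : 'rV[R]_n) (A : 'M[R]_n).

(** [slope_below f z p] for all [z], with some [p] depending on [z], says that
[f + L / 2 * sq] is convex; the opposite inequality says that
[f - L / 2 * sq] is concave. *)
Definition slope_below f z p := forall w,
  f z + dotv p (w - z) - L / 2 * sq (w - z) <= f w.

Definition slope_above f z p := forall w,
  f w <= f z + dotv p (w - z) + L / 2 * sq (w - z).

Definition slope f z p := slope_below f z p /\ slope_above f z p.

Lemma dotv_norm_le p w : 2 * `|dotv p w| <= (sq p + n%:R) * `|w|.
Proof.
have [->|w0] := eqVneq w 0; first by rewrite dotv0r !normr0 !mulr0.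
have w1 : 0 < `|w| by rewrite normr_gt0.
have H q : 2 * dotv q w <= (sq q + n%:R) * `|w|.
  apply: (le_trans (dotv_young _ q w w1)); rewrite mulrDl mulrC lerD2l.
  rewrite ler_pdivrMl// (le_trans (sq_le_norm w))//; lra.
rewrite -[2]gtr0_norm// -normrM ler_norml H andbT.
by have := H (- p); rewrite sqN dotvNl; lra.
Qed.

(** The inequality at [z] bounds [f] from below near [z], the one at a nearby [w],
read at [z], bounds [f w] from above. *)
Lemma slope_below_continuous f (c : R) :
  (forall z, exists2 p, slope_below f z p & sq p <= c * (sq z + 1)) ->
  continuous f.
Proof.
move=> H z; have [p pz _] := H z.
have hw : id @ nbhs z --> z by exact: cvg_id.
have FF : Filter (nbhs z) := nbhs_filter z.
have h0 : (fun w => w - z) @ nbhs z --> (0 : 'rV[R]_n).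
  by rewrite -(subrr z); apply: cvgB => //; exact: cvg_cst.
have h1 : (fun w => L / 2 * sq (w - z)) @ nbhs z --> (0 : R).
  rewrite -(mulr0 (L / 2)) -(@sq0 R n); apply: cvgM; first exact: cvg_cst.
  exact: cvg_sq.
have h2 : (fun w => dotv p (w - z)) @ nbhs z --> (0 : R).
  by rewrite -(dotv0r p); apply: cvg_dotv => //; exact: cvg_cst.
have h3 : (fun w => (c * (sq w + 1) + n%:R) * `|w - z|) @ nbhs z --> (0 : R).
  rewrite -(mulr0 (c * (sq z + 1) + n%:R)) -(@normr0 _ 'rV[R]_n).
  apply: cvgM; last exact: cvg_norm.
  apply: cvgD; last exact: cvg_cst.
  apply: cvgM; first exact: cvg_cst.
  by apply: cvgD; [exact: cvg_sq|exact: cvg_cst].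
have lo : (fun w => f z + dotv p (w - z) - L / 2 * sq (w - z)) @ nbhs z --> f z.
  rewrite -[X in _ --> X]addr0 -[X in _ --> X]subr0 -{2}(addr0 (f z)).
  by rewrite [X in _ --> X - _]addr0; apply: cvgB => //; apply: cvgD => //; exact: cvg_cst.
have up : (fun w => f z + 2^-1 * ((c * (sq w + 1) + n%:R) * `|w - z|)
    + L / 2 * sq (w - z)) @ nbhs z --> f z.
  rewrite -[X in _ --> X]addr0; apply: cvgD => //.
  rewrite -[X in _ --> X]addr0; apply: cvgD; first exact: cvg_cst.
  by rewrite -(mulr0 2^-1); apply: cvgM => //; exact: cvg_cst.
apply: squeeze_cvgr lo up; apply: filterE => w; rewrite pz /=.
have [q qw qc] := H w; have := qw z; rewrite [sq (z - w)]sqBC => {}qw.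
have := dotv_norm_le q (w - z).
have : (sq q + n%:R) * `|w - z| <= (c * (sq w + 1) + n%:R) * `|w - z|.
  by rewrite ler_wpM2r// lerD2r.
have := ler_norm (dotv q (w - z)).
by rewrite -[z - w]opprB dotvNr in qw *; lra.
Qed.

(** A function of class C^{1,1} has a Lipschitz gradient, and this needs the
two-sided bounds at the two points only. Comparing the paraboloids at
[z2 + h], the choice [h = (3 * L)^-1 *: (p2 - p1)] makes the
linear terms dominate. *)
Lemma slope_lipschitz f z1 z2 p1 p2 : 0 < L -> slope f z1 p1 -> slope f z2 p2 ->
  sq (p1 - p2) <= 9 * L ^+ 2 * sq (z1 - z2).
Proof.
move=> L0 [lo1 up1] [lo2 up2].
pose h := (3 * L)^-1 *: (p2 - p1); pose d := z2 - z1.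
have E1 : z2 + h - z1 = d + h by rewrite addrAC.
have E2 : z2 + h - z2 = h by rewrite addrAC subrr add0r.
have := up1 (z2 + h); have := lo2 (z2 + h); have := lo1 z2.
have := sqD_le d h; rewrite E1 E2 -/d.
have hE : dotv (p2 - p1) h = (3 * L)^-1 * sq (p2 - p1) by rewrite dotvZr.
have hsq : sq h = (3 * L)^-1 ^+ 2 * sq (p2 - p1) by rewrite sqZ.
have -> : sq (p1 - p2) = 9 * L ^+ 2 * sq h.
  by rewrite hsq sqBC; field; rewrite gt_eqF.
have -> : sq (z1 - z2) = sq d by rewrite sqBC.
have {}hE : dotv p2 h - dotv p1 h = 3 * L * sq h.
  by rewrite hsq -dotvNl -dotvDl hE; field; rewrite gt_eqF.
rewrite dotvDr => a1 a2 a3 a4.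
have : L * sq (d + h) <= L * (2 * sq d + 2 * sq h) by rewrite ler_wpM2l// ltW.
move=> a5; have : L * sq h <= L * sq d by lra.
rewrite ler_pM2l// => hd; apply: ler_wpM2l => //.
by rewrite mulr_ge0// sqr_ge0.
Qed.

(** Along a short step in the direction of [p - q] the linear terms would
dominate both quadratic ones. *)
Lemma touch_slope f z p q A : slope_below f z p -> touch f z q A -> p = q.
Proof.
move=> fp [_ [r r0 fq]]; apply/eqP; rewrite -subr_eq0; apply/eqP/sq_eq0/eqP.
rewrite eq_le sq_ge0 andbT leNgt; apply/negP; set s := sq (p - q) => s0.
pose C := L / 2 * s + 2^-1 * quadv A (p - q).
pose t := Num.min (Num.min 1 (r / s)) (s / (2 * (`|C| + 1))).
have C0 : 0 < 2 * (`|C| + 1) by have := normr_ge0 C; lra.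
have t0 : 0 < t by rewrite !lt_min ltr01/= !divr_gt0.
have t1 : t <= 1 by rewrite !ge_min lexx.
have ts : t * s <= r by rewrite -ler_pdivlMr// !ge_min lexx orbT.
have tC : t * (2 * (`|C| + 1)) <= s by rewrite -ler_pdivlMr// !ge_min lexx !orbT.
have tr : sq (t *: (p - q)) <= r.
  rewrite sqZ -/s; apply: le_trans ts.
  by rewrite expr2 -mulrA ler_piMl// mulr_ge0// ltW.
have := fq _ tr; have := fp (z + t *: (p - q)).
rewrite [z + _ - z]addrAC subrr add0r sqZ quadvZr !dotvZr -/s => a1 a2.
have E : dotv p (p - q) - dotv q (p - q) = s by rewrite -dotvNl -dotvDl.
have : t * s <= t * (t * C) by rewrite -E /C; lra.
rewrite ler_pM2l// => sC.
have : t * C <= t * `|C| by rewrite ler_pM2l// ler_norm.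
have : 0 <= t * `|C| by rewrite mulr_ge0// ltW.
lra.
Qed.

(** The point [z] is a contact point of the graph of [f + g] with an affine function
lying above it, and [p] and [q] split the slope of that function into
gradients of [f] and [g]. *)
Definition split_contact f g z p q := [/\ slope f z p, slope g z q &
  forall w, f w + g w <= f z + g z + dotv (p + q) (w - z)].

Definition split_contact_everywhere f g := forall z, exists p q, split_contact f g z p q.

(** The normalization at the origin (value and gradient zero) that makes families
of rescaled functions compact. *)
Definition normalized f := forall z, `|f z| <= L / 2 * sq z.

Lemma normalized0 f : normalized f -> f 0 = 0.
Proof.
by move=> /(_ 0); rewrite sq0 mulr0 normr_le0 => /eqP.
Qed.

Lemma normalized_slope f : normalized f -> slope f 0 0.
Proof.
move=> nf; split=> w; rewrite (normalized0 _ nf) subr0 dotv0l !add0r;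
  by have := nf w; rewrite ler_norml => /andP[]; lra.
Qed.

Lemma slope_continuous f : 0 < L -> (forall z, exists p, slope f z p) ->
  continuous f.
Proof.
move=> L0 H; have [p0 f0] := H 0.
apply: (@slope_below_continuous _ (18 * L ^+ 2 + 2 * sq p0)) => z.
have [p fp] := H z; exists p; first by case: fp.
have := slope_lipschitz _ _ _ _ _ L0 fp f0; rewrite subr0.
have := sqD_le (p - p0) p0; rewrite subrK.
have := sq_ge0 p0; have := sq_ge0 z => a b c d.
have : 0 <= sq p0 * sq z by rewrite mulr_ge0.
have := sqr_ge0 L; lra.
Qed.

End Slopes.

(** * Rescaling around a point *)

Section Rescaling.
Context {R : realType} {n : nat} {L : R}.
Implicit Types (f g : 'rV[R]_n -> R) (p q z h w : 'rV[R]_n) (A : 'M[R]_n) (r : R).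

(** The parabolic rescaling keeps the constant [L], and leaves the matrices of
touching paraboloids unchanged. *)
Definition rescale f z0 r p z := (f (z0 + r *: z) - f z0 - r * dotv p z) / r ^+ 2.

Lemma slope_below_rescale f z0 r p z q : 0 < r ->
  slope_below L f (z0 + r *: z) q ->
  slope_below L (rescale f z0 r p) z (r^-1 *: (q - p)).
Proof.
move=> r0 H w; have := H (z0 + r *: w).
have -> : z0 + r *: w - (z0 + r *: z) = r *: (w - z).
  by rewrite opprD addrACA subrr add0r scalerBr.
rewrite sqZ /rescale !dotvE => H1.
have r2 : 0 < r ^+ 2 by rewrite exprn_gt0.
rewrite ler_pdivlMr// -subr_ge0; move: H1; rewrite -subr_ge0.
by congr (_ <= _); field; rewrite gt_eqF.
Qed.

Lemma slope_above_rescale f z0 r p z q : 0 < r ->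
  slope_above L f (z0 + r *: z) q ->
  slope_above L (rescale f z0 r p) z (r^-1 *: (q - p)).
Proof.
move=> r0 H w; have := H (z0 + r *: w).
have -> : z0 + r *: w - (z0 + r *: z) = r *: (w - z).
  by rewrite opprD addrACA subrr add0r scalerBr.
rewrite sqZ /rescale !dotvE => H1.
have r2 : 0 < r ^+ 2 by rewrite exprn_gt0.
rewrite ler_pdivrMr// -subr_ge0; move: H1; rewrite -subr_ge0.
by congr (_ <= _); field; rewrite gt_eqF.
Qed.

Lemma slope_rescale f z0 r p z q : 0 < r -> slope L f (z0 + r *: z) q ->
  slope L (rescale f z0 r p) z (r^-1 *: (q - p)).
Proof.
by move=> r0 [? ?]; split; [exact: slope_below_rescale|exact: slope_above_rescale].
Qed.

Lemma split_contact_rescale f g z0 r p p' z q q' : 0 < r ->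
  split_contact L f g (z0 + r *: z) q q' ->
  split_contact L (rescale f z0 r p) (rescale g z0 r p') z
    (r^-1 *: (q - p)) (r^-1 *: (q' - p')).
Proof.
move=> r0 [fq gq H]; split; [exact: slope_rescale|exact: slope_rescale|move=> w].
have := H (z0 + r *: w).
have -> : z0 + r *: w - (z0 + r *: z) = r *: (w - z).
  by rewrite opprD addrACA subrr add0r scalerBr.
have r2 : 0 < r ^+ 2 by rewrite exprn_gt0.
rewrite /rescale !dotvE => H1.
rewrite -subr_ge0 -(pmulr_rge0 _ r2); move: H1; rewrite -subr_ge0.
by congr (_ <= _); field; rewrite gt_eqF.
Qed.

Lemma rescale_normalized f z0 r p : 0 < r -> slope L f z0 p -> normalized L (rescale f z0 r p).
Proof.
move=> r0 fp z; have r2 : 0 < r ^+ 2 by rewrite exprn_gt0.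
have := fp; rewrite -{1}(addr0 z0) -(scaler0 _ r) => /(slope_rescale _ _ _ p _ _ r0).
rewrite subrr scaler0 => -[/(_ z) a /(_ z) b]; move: a b.
have -> : rescale f z0 r p 0 = 0.
  by rewrite /rescale scaler0 addr0 dotv0r mulr0 subr0 subrr mul0r.
by rewrite subr0 dotv0l ler_norml => a b; apply/andP; split; lra.
Qed.

Lemma touch_rescale f z0 r p z q A : 0 < r -> touch (rescale f z0 r p) z q A ->
  touch f (z0 + r *: z) (p + r *: q) A.
Proof.
move=> r0 [sA [s s0 H]]; split => //.
have r2 : 0 < r ^+ 2 by rewrite exprn_gt0.
exists (r ^+ 2 * s) => [|h hs]; first by rewrite mulr_gt0.
pose k := r^-1 *: h.
have hE : h = r *: k by rewrite scalerA divff ?gt_eqF// scale1r.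
have : sq k <= s by rewrite sqZ exprVn mulrC ler_pdivrMr// mulrC.
move: k hE => k -> /H; rewrite /rescale scalerDr addrA quadvZr !dotvE => H1.
rewrite -subr_ge0; move: H1; rewrite -subr_ge0 -(pmulr_rge0 _ r2).
by congr (_ <= _); field; rewrite gt_eqF.
Qed.

End Rescaling.

(** * Limits of functions along an ultrafilter *)

Section FunctionLimits.
Context {R : realType} {n : nat} (U : set_system nat) {UU : UltraFilter U}.
Implicit Types (f g : 'rV[R]_n -> R) (p q z h w : 'rV[R]_n) (A : 'M[R]_n).

(** Continuous convergence; unlike pointwise convergence it passes to the limit at
moving points of contact. *)
Definition fun_cvg (f_ : nat -> 'rV[R]_n -> R) f := forall x_ z,
  x_ @ U --> z -> f_ k (x_ k) @[k --> U] --> f z.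

Lemma fun_cvg_pt (f_ : nat -> 'rV[R]_n -> R) f z : fun_cvg f_ f ->
  f_ k z @[k --> U] --> f z.
Proof. by move=> H; apply: (H (cst z)); exact: cvg_cst. Qed.

Lemma cvg_sub0 (x_ y_ : nat -> 'rV[R]_n) z : x_ @ U --> z -> y_ @ U --> z ->
  (x_ k - y_ k) @[k --> U] --> (0 : 'rV[R]_n).
Proof. by move=> xz yz; rewrite -(subrr z); exact: cvgB. Qed.

Lemma cvg_sq_sub0 (c : R) (x_ y_ : nat -> 'rV[R]_n) z :
  x_ @ U --> z -> y_ @ U --> z ->
  c * sq (x_ k - y_ k) @[k --> U] --> (0 : R).
Proof.
move=> xz yz; rewrite -(mulr0 c) -(@sq0 R n); apply: cvgM; first exact: cvg_cst.
by apply: cvg_sq; exact: (cvg_sub0 _ _ z).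
Qed.

Lemma cvg_dotv_sub0 (p_ x_ y_ : nat -> 'rV[R]_n) p z : p_ @ U --> p ->
  x_ @ U --> z -> y_ @ U --> z ->
  dotv (p_ k) (x_ k - y_ k) @[k --> U] --> (0 : R).
Proof.
by move=> pp xz yz; rewrite -(dotv0r p); apply: cvg_dotv => //; exact: (cvg_sub0 _ _ z).
Qed.

Lemma slope_limit_cvg (L : R) (f_ : nat -> 'rV[R]_n -> R) z (l : R)
    (z_ p_ x_ : nat -> 'rV[R]_n) p :
  f_ k z @[k --> U] --> l -> z_ @ U --> z -> p_ @ U --> p ->
  (\forall k \near U, slope L (f_ k) (z_ k) (p_ k)) -> x_ @ U --> z ->
  f_ k (x_ k) @[k --> U] --> l.
Proof.
move=> fl zz pp H xz.
pose e k := L / 2 * sq (x_ k - z_ k) + L / 2 * sq (z - z_ k).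
have zc : (fun=> z) @ U --> z by exact: cvg_cst.
have e0 : e @ U --> (0 : R).
  by rewrite -(addr0 0); apply: cvgD; exact: (cvg_sq_sub0 _ _ _ z).
have d0 := cvg_dotv_sub0 _ _ _ _ _ pp xz zc.
have lo : (fun k => f_ k z + dotv (p_ k) (x_ k - z) - e k) @ U --> l.
  rewrite -[l]addr0 -[l + 0]subr0; apply: cvgB => //; exact: cvgD.
have up : (fun k => f_ k z + dotv (p_ k) (x_ k - z) + e k) @ U --> l.
  rewrite -[l]addr0 -[l + 0]addr0; apply: cvgD => //; exact: cvgD.
apply: squeeze_cvgr lo up; apply: filterS H => k [b a].
have := b (x_ k); have := a (x_ k); have := b z; have := a z.
rewrite /e !dotvE => *; apply/andP; split; lra.
Qed.

Lemma slope_limit (L : R) (f_ : nat -> 'rV[R]_n -> R) f z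
    (z_ p_ : nat -> 'rV[R]_n) p :
  fun_cvg f_ f -> z_ @ U --> z -> p_ @ U --> p ->
  (\forall k \near U, slope L (f_ k) (z_ k) (p_ k)) -> slope L f z p.
Proof.
move=> ff zz pp H.
have E w : (f_ k (z_ k) + dotv (p_ k) (w - z_ k)) @[k --> U] -->
    f z + dotv p (w - z).
  apply: cvgD; first exact: (ff _ _ _).
  by apply: cvg_dotv => //; apply: cvgB => //; exact: cvg_cst.
have S w : (L / 2 * sq (w - z_ k)) @[k --> U] --> L / 2 * sq (w - z).
  apply: cvgM; first exact: cvg_cst.
  by apply: cvg_sq; apply: cvgB => //; exact: cvg_cst.
split=> w.
  apply: (ler_cvg_to (cvgB (E w) (S w)) (fun_cvg_pt _ _ w ff)).
  by apply: filterS H => k [b _]; exact: b.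
apply: (ler_cvg_to (fun_cvg_pt _ _ w ff) (cvgD (E w) (S w))).
by apply: filterS H => k [_ a]; exact: a.
Qed.

Lemma normalized_limit (L : R) (f_ : nat -> 'rV[R]_n -> R) f :
  fun_cvg f_ f -> (forall k, normalized L (f_ k)) -> normalized L f.
Proof.
move=> ff nf z; apply: (ler_cvg_to (cvg_norm (fun_cvg_pt _ _ z ff)) (cvg_cst _)).
by apply: filterE => k; exact: nf.
Qed.

(** Compactness. The bounds of [normalized] make the values converge pointwise
and, by [slope_lipschitz], make the slopes at [z_ k] bounded; the paraboloids at
[z_ k] then control the functions near [z]. The contact points are only
required to accumulate at every [z], so that the lemma applies to rescalings
around points where contact points are dense at the relevant scale. *)
Lemma split_contact_ultralimit (L : R) (f_ g_ : nat -> 'rV[R]_n -> R) : 0 < L ->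
  (forall k, normalized L (f_ k)) -> (forall k, normalized L (g_ k)) ->
  (forall z, exists2 z_, z_ @ U --> z &
    \forall k \near U, exists p q, split_contact L (f_ k) (g_ k) (z_ k) p q) ->
  exists f g, [/\ fun_cvg f_ f, fun_cvg g_ g & split_contact_everywhere L f g].
Proof.
move=> L0 nf ng H.
have lim (h_ : nat -> 'rV[R]_n -> R) : (forall k, normalized L (h_ k)) ->
    exists h : 'rV[R]_n -> R, forall z, h_ k z @[k --> U] --> h z.
  move=> nh; suff /choice[h ?] : forall z, exists l : R, h_ k z @[k --> U] --> l.
    by exists h.
  move=> z; apply: (bounded_ultralimit _ _ (L / 2 * sq z)).
  by apply: filterE => k; exact: nh.
have [f Hf] := lim _ nf; have [g Hg] := lim _ ng.
have K z : exists (z_ p_ q_ : nat -> 'rV[R]_n) (p q : 'rV[R]_n), [/\ z_ @ U --> z, p_ @ U --> p, q_ @ U --> q &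
    \forall k \near U, split_contact L (f_ k) (g_ k) (z_ k) (p_ k) (q_ k)].
  have [z_ zz Hz] := H z.
  have /choice[pq Hpq] : forall k, exists pq : 'rV[R]_n * 'rV[R]_n,
      (exists p q, split_contact L (f_ k) (g_ k) (z_ k) p q) ->
      split_contact L (f_ k) (g_ k) (z_ k) pq.1 pq.2.
    move=> k; have [[p [q pq]]|no] := pselect (exists p q, split_contact L (f_ k) (g_ k) (z_ k) p q).
      by exists (p, q).
    by exists (0, 0).
  have {}Hz : \forall k \near U, split_contact L (f_ k) (g_ k) (z_ k) (pq k).1 (pq k).2.
    by apply: filterS Hz => k; exact: Hpq.
  have zb : \forall k \near U, sq (z_ k) <= sq z + 1.
    apply: (cvgr_le (sq z)); first exact: cvg_sq.
    by rewrite ltrDl.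
  have [p pp] : exists p : 'rV[R]_n, (fun k => (pq k).1) @ U --> p.
    apply: (bounded_ultralimit_sq _ _ (9 * L ^+ 2 * (sq z + 1))).
    apply: filterS2 Hz zb => k [fp _ _] zk.
    have := slope_lipschitz _ _ _ _ _ _ L0 fp (normalized_slope _ _ (nf k)).
    rewrite !subr0 => /le_trans; apply; apply: ler_wpM2l => //.
    by rewrite mulr_ge0// sqr_ge0.
  have [q qq] : exists q : 'rV[R]_n, (fun k => (pq k).2) @ U --> q.
    apply: (bounded_ultralimit_sq _ _ (9 * L ^+ 2 * (sq z + 1))).
    apply: filterS2 Hz zb => k [_ fp _] zk.
    have := slope_lipschitz _ _ _ _ _ _ L0 fp (normalized_slope _ _ (ng k)).
    rewrite !subr0 => /le_trans; apply; apply: ler_wpM2l => //.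
    by rewrite mulr_ge0// sqr_ge0.
  by exists z_, (fun k => (pq k).1), (fun k => (pq k).2), p, q; split.
have cf : fun_cvg f_ f.
  move=> x_ z xz; have [z_ [p_ [q_ [p [q [zz pp _ Hz]]]]]] := K z.
  apply: (slope_limit_cvg L _ _ _ _ _ _ _ (Hf z) zz pp _ xz).
  by apply: filterS Hz => k [? ? ?].
have cg : fun_cvg g_ g.
  move=> x_ z xz; have [z_ [p_ [q_ [p [q [zz _ qq Hz]]]]]] := K z.
  apply: (slope_limit_cvg L _ _ _ _ _ _ _ (Hg z) zz qq _ xz).
  by apply: filterS Hz => k [? ? ?].
exists f, g; split=> // z; have [z_ [p_ [q_ [p [q [zz pp qq Hz]]]]]] := K z.
exists p, q; split.
- by apply: (slope_limit _ _ _ _ _ _ _ cf zz pp); apply: filterS Hz => k [? ? ?].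
- by apply: (slope_limit _ _ _ _ _ _ _ cg zz qq); apply: filterS Hz => k [? ? ?].
move=> w; apply: (@ler_cvg_to _ U _ _ (fun k => f_ k w + g_ k w)
  (fun k => f_ k (z_ k) + g_ k (z_ k) + dotv (p_ k + q_ k) (w - z_ k))).
- by apply: cvgD; exact: fun_cvg_pt.
- apply: cvgD; first by apply: cvgD; [exact: (cf _ _ zz)|exact: (cg _ _ zz)].
  by apply: cvg_dotv; [exact: cvgD|apply: cvgB => //; exact: cvg_cst].
- by apply: filterS Hz => k [? ? ?].
Qed.

(** Adding [e%:M] makes the contact strict on a sphere. If the functions [f_ k] did not
stay strictly below on that sphere, points of the sphere where they fail to
would converge to a point where the limit fails to. *)
Lemma touch_stable (f_ : nat -> 'rV[R]_n -> R) f z p A (e : R) :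
  fun_cvg f_ f -> (forall k, continuous (f_ k)) -> touch f z p A -> 0 < e ->
  exists r, \forall k \near U, exists z' p',
    sq (z' - z) <= r /\ touch (f_ k) z' p' (A + e%:M).
Proof.
move=> ff cf [sA [r r0 H]] e0; exists r.
set P := (X in \forall k \near U, X k).
have [//|UnP] := in_ultra_setVsetC P UU; exfalso.
have sB : symm (A + e%:M) by apply: symmD => //; exact: symm_scalar.
pose Q k h := sq h = r /\
  f_ k z <= f_ k (z + h) - (dotv p h + 2^-1 * quadv (A + e%:M) h).
have /choice[h_ Hh] : forall k, exists h, ~ P k -> Q k h.
  move=> k; have [|no] := pselect (exists h, Q k h).
    by move=> [h Qh]; exists h.
  exists 0 => nP; exfalso; apply: nP.
  have [|h0 [p' [h0r t]]] := interior_touch (f_ k) z p _ r (cf k) sB r0.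
    by move=> h hr; rewrite ltNge; apply/negP => le; apply: no; exists h.
  by exists (z + h0), p'; split => //; rewrite addrAC subrr add0r ltW.
have {}UnP : \forall k \near U, Q k (h_ k).
  by apply: filterS UnP => k; exact: Hh.
have [h hh] : exists h : 'rV[R]_n, h_ @ U --> h.
  by apply: (bounded_ultralimit_sq _ _ r); apply: filterS UnP => k [-> _].
have hr : sq h = r.
  apply/eqP; rewrite eq_le; apply/andP; split.
    apply: (ler_cvg_to (cvg_sq _ _ _ hh) (cvg_cst r)).
    by apply: filterS UnP => k [->].
  apply: (ler_cvg_to (cvg_cst r) (cvg_sq _ _ _ hh)).
  by apply: filterS UnP => k [->].
have zh : (fun k => z + h_ k) @ U --> z + h.
  by apply: cvgD => //; exact: cvg_cst.
have : f z <= f (z + h) - (dotv p h + 2^-1 * quadv (A + e%:M) h).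
  apply: (@ler_cvg_to _ U _ _ (fun k => f_ k z)
    (fun k => f_ k (z + h_ k) - (dotv p (h_ k) + 2^-1 * quadv (A + e%:M) (h_ k)))).
  - exact: fun_cvg_pt.
  - apply: cvgB; first exact: (ff _ _ zh).
    apply: cvgD; first by apply: cvg_dotv => //; exact: cvg_cst.
    apply: cvgM; first exact: cvg_cst.
    by apply: cvg_quadv => //; exact: cvg_cst.
  - by apply: filterS UnP => k [].
have := H h; rewrite hr lexx => /(_ isT).
rewrite quadvDl quadv_scalar hr; have := mulr_gt0 e0 r0; lra.
Qed.

End FunctionLimits.

(** * The strong maximum principle *)

Section StrongMaximum.
Context {R : realType} {n : nat}.
Implicit Types (f g : 'rV[R]_n -> R) (p q z h w e : 'rV[R]_n) (A : 'M[R]_n).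

Lemma dotv_CauchySchwarz e h : dotv e h ^+ 2 <= sq e * sq h.
Proof.
have [->|e0] := eqVneq e 0; first by rewrite dotv0l sq0 expr0n mul0r.
have s0 := sq_gt0 _ e0; have := sq_ge0 (sq e *: h - dotv e h *: e).
rewrite sqB !sqZ !dotvE (dotvC h e) => H.
rewrite -subr_ge0 -(pmulr_rge0 _ s0); move: H.
by congr (_ <= _); ring.
Qed.

(** A quadratic substitute for Hopf's exponential barrier on the ball
[sq (e + h) < sq e]. Its second derivative in the direction [e] is large, so
its Laplacian [- 4 * n%:R + 2 * c * sq e] can be made positive. *)
Definition barrier (c : R) e h : R := - 2 * dotv e h - 2 * sq h + c * dotv e h ^+ 2.

(** The points [h] with [sq (e + h) < sq e] form a ball with the origin on its
boundary; near the origin the barrier is negative outside this ball, since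
there [- 2 * dotv e h] is at most [sq h]. *)
Lemma barrier_lt0 (c r : R) e h : 0 < c -> c ^+ 2 * sq e * r <= 4 -> c * r < 4 ->
  0 < sq h -> sq h <= r -> sq e <= sq (e + h) -> barrier c e h < 0.
Proof.
move=> c0 cr1 cr2 h0 hr; rewrite sqD /barrier; have := dotv_CauchySchwarz e h.
set t := dotv e h; set s := sq h in h0 hr *; set E := sq e in cr1 * => CS out.
have E0 : 0 <= E by exact: sq_ge0.
have [t0|t0] := lerP 0 t.
  have ct : c * t <= 2.
    rewrite -(ler_pXn2r (ltn0Sn 1)) ?nnegrE//; last by rewrite mulr_ge0// ltW.
    rewrite exprMn; apply: (@le_trans _ _ (c ^+ 2 * (E * r))).
      by rewrite ler_pM2l ?exprn_gt0// (le_trans CS)// ler_wpM2l.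
    by rewrite mulrA; lra.
  have : t * (c * t) <= t * 2 by rewrite ler_wpM2l.
  by rewrite expr2; lra.
have : c * (4 * t ^+ 2) <= c * s ^+ 2.
  rewrite ler_pM2l//.
  have -> : 4 * t ^+ 2 = (- (2 * t)) ^+ 2 by ring.
  by rewrite lerXn2r ?nnegrE//; lra.
have : s * (c * s) < s * 4.
  by rewrite ltr_pM2l// (le_lt_trans _ cr2)// ler_pM2l.
by rewrite expr2; lra.
Qed.

(** Hopf's argument. The difference of [f] and the quadratic form of [A] vanishes at
[z0] and is negative inside a ball with [z0] on its boundary. Adding a small
multiple of the barrier keeps it negative on a small sphere around [z0], outside the
ball because of the barrier and inside by compactness, so that [interior_touch] yields
a touching matrix whose trace is smaller by twice the multiple [k]. *)
Lemma touch_from_barrier f A e z0 : continuous f -> symm A ->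
  (forall z, f z <= 2^-1 * quadv A z) -> f z0 = 2^-1 * quadv A z0 ->
  0 < sq e ->
  (forall h, sq (e + h) < sq e -> f (z0 + h) < 2^-1 * quadv A (z0 + h)) ->
  exists z p B, touch f z p B /\ \tr B < \tr A.
Proof.
move=> cf sA fA f0 e0 ball.
pose c := (2 * n%:R + 1) / sq e.
have n0 : (0 : R) <= n%:R by [].
have c0 : 0 < c by rewrite divr_gt0//; lra.
have ce : c * sq e = 2 * n%:R + 1 by rewrite /c divfK// gt_eqF.
pose r := Num.min (4 / (c ^+ 2 * sq e)) (2 / c).
have ce0 : 0 < c ^+ 2 * sq e by rewrite mulr_gt0// exprn_gt0.
have r0 : 0 < r by rewrite lt_min !divr_gt0.
have r1 : c ^+ 2 * sq e * r <= 4.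
  by rewrite mulrC -ler_pdivlMr// ge_min lexx.
have r2 : c * r < 4.
  have : r <= 2 / c by rewrite ge_min lexx orbT.
  by rewrite ler_pdivlMr// mulrC; lra.
have inball h : sq h = r -> 0 <= barrier c e h ->
    f (z0 + h) < 2^-1 * quadv A (z0 + h).
  move=> hr b0; apply: ball; rewrite ltNge; apply/negP => out.
  have : barrier c e h < 0 by apply: (barrier_lt0 c r) => //; rewrite hr.
  by rewrite ltNge b0.
(* Compactness of the part of the sphere where the barrier is nonnegative. *)
have [m m0 Hm] : exists2 m, 0 < m & forall h, sq h = r -> 0 <= barrier c e h ->
    f (z0 + h) - 2^-1 * quadv A (z0 + h) <= - m.
  pose S := [set h | sq h <= r] `&`
    ([set h | r <= sq h] `&` [set h | 0 <= barrier c e h]).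
  have [S0|S0] := pselect (S !=set0); last first.
    exists 1 => // h hr b0; exfalso; apply: S0; exists h.
    by split; [rewrite /= hr|split; rewrite /= ?hr].
  have clo (u : 'rV[R]_n -> R) (a : R) : continuous u -> closed [set h | a <= u h].
    move=> cu; apply: (@preimage_closed _ _ u [set x | a <= x]); last exact: closed_ge.
    by move=> h _; exact: cu.
  have csq : continuous (sq : 'rV[R]_n -> R).
    by move=> h; have FF : Filter (nbhs h) := nbhs_filter h; apply: cvg_sq; exact: cvg_id.
  have cb : continuous (barrier c e).
    move=> h; have FF : Filter (nbhs h) := nbhs_filter h.
    have h1 : (fun k => dotv e k) @ nbhs h --> dotv e h.
      by apply: cvg_dotv; [exact: cvg_cst|exact: cvg_id].
    apply: cvgD; last by apply: cvgM; [exact: cvg_cst|exact: cvgM].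
    apply: cvgB; apply: cvgM => //; try exact: cvg_cst.
    exact: csq.
  have cS : compact S.
    apply: compact_closedI; first exact: compact_sq_ball.
    by apply: closedI; exact: clo.
  have cw : continuous (fun h => f (z0 + h) - 2^-1 * quadv A (z0 + h)).
    move=> h; have FF : Filter (nbhs h) := nbhs_filter h.
    have h1 : (fun k => z0 + k) @ nbhs h --> z0 + h.
      by apply: cvgD; [exact: cvg_cst|exact: cvg_id].
    apply: cvgB; first exact: (@continuous_cvg _ _ _ _ FF _ f _ (cf _) h1).
    by apply: cvgM; [exact: cvg_cst|apply: cvg_quadv => //; exact: cvg_cst].
  have [h0] := @compact_EVT_max _ _ _ _ S0 cS (continuous_subspaceT cw).
  rewrite inE => -[a1 [a2 a3]] Hmax.
  exists (- (f (z0 + h0) - 2^-1 * quadv A (z0 + h0))).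
    rewrite oppr_gt0 subr_lt0; apply: inball => //.
    by apply/eqP; rewrite eq_le; apply/andP.
  move=> h hr b0; rewrite opprK; apply: Hmax; rewrite inE.
  by split; [rewrite /= hr|split; rewrite /= ?hr].
pose V := sq e + r + c * (sq e * r).
have V0 : 0 < V by rewrite /V; do ![apply: addr_gt0 => //|apply: mulr_gt0 => //].
have bV h : sq h = r -> barrier c e h <= V.
  move=> hr; rewrite /barrier /V.
  have : c * dotv e h ^+ 2 <= c * (sq e * r) by rewrite ler_pM2l// -hr dotv_CauchySchwarz.
  have := sq_ge0 (e + h); rewrite sqD hr; lra.
pose k := m / (2 * V).
have k0 : 0 < k by rewrite divr_gt0// mulr_gt0.
have kV : k * V = m / 2 by rewrite /k; field; rewrite gt_eqF.
(* The Hessian of half the form of [A] minus [k] times the barrier. *)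
pose B := A + (4 * k)%:M - (2 * k * c) *: (e^T *m e).
have sB : symm B.
  apply: symmD; first by apply: symmD => //; exact: symm_scalar.
  by apply: symmN; apply: symmZ; exact: symm_sqr.
have BE h : 2^-1 * quadv B h = 2^-1 * quadv A h + 2 * k * sq h - k * c * dotv e h ^+ 2.
  by rewrite /B !quadvDl quadvNl quadvZl quadv_sqr quadv_scalar; field.
have [|z [p [_ t]]] := interior_touch f z0 (z0 *m A + (2 * k) *: e) B r cf sB r0.
  move=> h hr; rewrite BE !dotvE f0.
  have AE := quadvD A z0 h sA.
  have [b0|b0] := lerP 0 (barrier c e h).
    have := Hm _ hr b0; rewrite AE.
    have : k * barrier c e h <= k * V by rewrite ler_pM2l// bV.
    rewrite kV /barrier; lra.
  have := fA (z0 + h); rewrite AE.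
  have : k * barrier c e h < 0 by rewrite pmulr_rlt0.
  rewrite /barrier; lra.
exists (z0 + z), p, B; split => //.
rewrite /B !mxtraceD -scaleNr mxtraceZ trace_sqr mxtrace_scalar -mulr_natr mulNr.
have -> : 2 * k * c * sq e = 2 * k * (2 * n%:R + 1) by rewrite -(mulrA (2 * k) c) ce.
lra.
Qed.

(** If every matrix touching [f] has at least the trace of [A], then [f] is a viscosity
subsolution of the Poisson equation that the quadratic form solves. Being below
the form and equal to it at the origin, it coincides with it: otherwise
a largest ball around a point of strict inequality contradicts
[touch_from_barrier] at a boundary point [z0]. *)
Lemma strong_maximum f A : continuous f -> symm A ->
  (forall z, f z <= 2^-1 * quadv A z) -> f 0 = 0 ->
  (forall z p B, touch f z p B -> \tr A <= \tr B) ->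
  forall z, f z = 2^-1 * quadv A z.
Proof.
move=> cf sA fA f0 H z1; apply/eqP; rewrite eq_le fA /= leNgt; apply/negP => w1.
pose Z := [set z | sq z <= 4 * sq z1] `&` [set z | 0 <= f z - 2^-1 * quadv A z].
have Z0 : Z 0.
  by split; rewrite /= ?sq0 ?f0 ?quadv0r ?mulr0 ?subrr// mulr_ge0// sq_ge0.
have cZ : compact Z.
  apply: compact_closedI; first exact: compact_sq_ball.
  apply: (@preimage_closed _ _ (fun z => f z - 2^-1 * quadv A z) [set x | 0 <= x]); last exact: closed_ge.
  move=> h _; have FF : Filter (nbhs h) := nbhs_filter h.
  apply: cvgB; first exact: cf.
  apply: cvgM; first exact: cvg_cst.
  by apply: cvg_quadv; [exact: cvg_cst|exact: cvg_id].
have cd : continuous (fun z => sq (z - z1)).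
  move=> h; have FF : Filter (nbhs h) := nbhs_filter h.
  by apply: cvg_sq; apply: cvgB; [exact: cvg_id|exact: cvg_cst].
have [z0] := @compact_EVT_min _ _ _ _ (ex_intro _ 0 Z0) cZ (continuous_subspaceT cd).
rewrite inE => -[zr /=]; rewrite subr_ge0 => fz0 Hmin.
have {}fz0 : f z0 = 2^-1 * quadv A z0 by apply/eqP; rewrite eq_le fA.
have [z [p [B [t]]]] : exists z p B, touch f z p B /\ \tr B < \tr A; last first.
  by rewrite ltNge (H _ _ _ t).
apply: (touch_from_barrier f A (z0 - z1) z0) => //.
  apply: sq_gt0; rewrite subr_eq0; apply/eqP => E.
  by move: w1; rewrite -E fz0 ltxx.
move=> h; rewrite addrAC; move: (z0 + h) => z zz; rewrite ltNge; apply/negP => fz.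
have : Z z.
  split; last by rewrite /= subr_ge0.
  have := Hmin 0; rewrite inE => /(_ Z0); rewrite sub0r sqN => zz1.
  by rewrite /=; have := sqD_le (z - z1) z1; rewrite subrK; lra.
by rewrite -inE => /Hmin; rewrite leNgt zz.
Qed.

End StrongMaximum.

(** * Minimizing the trace over blow-ups *)

Section Rigidity.
Context {R : realType} {n : nat} (L : R) (L0 : 0 < L).
Context (U : set_system nat) {UU : UltraFilter U} (Uoo : \oo `<=` U).
Implicit Types (f g : 'rV[R]_n -> R) (p q z h w e : 'rV[R]_n) (A B : 'M[R]_n).

(** Dilating [h] to zero compares the two quadratic terms. *)
Lemma touch_matrix_ge f z p q A : slope_below L f z p -> touch f z q A ->
  forall h, - L * sq h <= quadv A h.
Proof.
move=> fp t h; have pq := touch_slope _ _ _ _ _ _ fp t.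
case: t => sA [r r0 H].
pose t := Num.min 1 (r / (sq h + 1)).
have h0 := sq_ge0 h; have h1 : 0 < sq h + 1 by lra.
have t0 : 0 < t by rewrite lt_min ltr01/= divr_gt0.
have t1 : t <= 1 by rewrite ge_min lexx.
have tr : t * (sq h + 1) <= r by rewrite -ler_pdivlMr// ge_min lexx orbT.
have ht : sq (t *: h) <= r.
  rewrite sqZ; apply: le_trans tr; rewrite expr2 -mulrA ler_pM2l//.
  by apply: le_trans (ler_piMl h0 t1) _; rewrite lerDl.
have := H _ ht; have := fp (z + t *: h).
rewrite [z + _ - z]addrAC subrr add0r sqZ quadvZr -pq => a b.
have t2 : 0 < t ^+ 2 by rewrite exprn_gt0.
by rewrite -(ler_pM2l t2); lra.
Qed.

Lemma near_ultrafilter (P : set nat) : (\forall k \near \oo, P k) -> \forall k \near U, P k.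
Proof. exact: Uoo. Qed.

Lemma cvg_ultrafilter (x_ : nat -> R) (l : R) : x_ @ \oo --> l -> x_ @ U --> l.
Proof. by move=> H B Bl; apply: Uoo; exact: H. Qed.

(** Classes of pairs of functions that are stable under zooming in and under the
corresponding limits; both members of a pair are always rescaled around the
same point and by the same factor. *)
Definition blowup_class (K : ('rV[R]_n -> R) -> ('rV[R]_n -> R) -> Prop) :=
  [/\ forall f g, K f g -> split_contact_everywhere L f g,
      forall f g z r p q, 0 < r -> K f g -> K (rescale f z r p) (rescale g z r q) &
      forall (f_ g_ : nat -> 'rV[R]_n -> R) f g, (forall k, K (f_ k) (g_ k)) ->
        (forall k, normalized L (f_ k)) -> (forall k, normalized L (g_ k)) ->
        fun_cvg U f_ f -> fun_cvg U g_ g -> K f g].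

(** Zooming in at the point of contact enlarges the ball on which the touching
paraboloid stays above the function. *)
Lemma blowup_touch K f g z p A (m : R) : blowup_class K -> K f g ->
  touch f z p A -> 0 < m ->
  exists f' g', [/\ K f' g', normalized L f', normalized L g' &
    forall h, sq h <= m -> f' h <= 2^-1 * quadv A h].
Proof.
move=> [K0 K1 _] Kfg t m0; have [p' [q [fp gq _]]] := K0 _ _ Kfg z.
have pp := touch_slope _ _ _ _ _ _ fp.1 t; rewrite -{}pp in t.
case: t => _ [r r0 H].
pose s := Num.min 1 (r / m).
have s0 : 0 < s by rewrite lt_min ltr01/= divr_gt0.
have s1 : s <= 1 by rewrite ge_min lexx.
have sr : s * m <= r by rewrite -ler_pdivlMr// ge_min lexx orbT.
exists (rescale f z s p'), (rescale g z s q); split.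
- exact: K1.
- exact: rescale_normalized.
- exact: rescale_normalized.
move=> h hm; have : sq (s *: h) <= r.
  rewrite sqZ; apply: le_trans sr; rewrite expr2 -mulrA ler_pM2l//.
  by apply: le_trans (ler_piMl (sq_ge0 h) s1) _.
move=> /H; rewrite dotvZr quadvZr /rescale => ?.
by rewrite ler_pdivrMr ?exprn_gt0//; lra.
Qed.

(** Almost minimizing touching matrices are turned by [blowup_touch] into pairs whose first
member lies below half the quadratic form on larger and larger balls.
A limit of these pairs and matrices attains the infimum of the traces. *)
Lemma trace_minimizer K f0 g0 : blowup_class K -> K f0 g0 ->
  exists f g A, [/\ K f g, normalized L f, symm A,
    forall z, f z <= 2^-1 * quadv A z &
    forall z p B, touch f z p B -> \tr A <= \tr B].
Proof.
move=> Kc K00; have [K0 K1 K2] := Kc.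
pose T : set R := [set t | exists f g z p A, [/\ K f g, touch f z p A & t = \tr A]].
have lbT : lbound T (- (n%:R * L)).
  move=> _ [f [g [z [p [A [Kfg t ->]]]]]].
  apply: trace_ge; have [p' [q [fp _ _]]] := K0 _ _ Kfg z.
  exact: touch_matrix_ge fp.1 t.
have T0 : T !=set0.
  have [p [q [fp _ _]]] := K0 _ _ K00 0.
  exists (\tr (L%:M : 'M[R]_n)), f0, g0, 0, p, L%:M; split => //.
  split; first exact: symm_scalar.
  exists 1 => // h _; have := fp.2 (0 + h).
  by rewrite !add0r subr0 quadv_scalar mulrA; lra.
have infT : has_inf T by split => //; exists (- (n%:R * L)).
set s := inf T in infT *.
have sT f g z p A : K f g -> touch f z p A -> s <= \tr A.
  move=> Kfg t; apply: ge_inf; first by exists (- (n%:R * L)).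
  by exists f, g, z, p, A.
have /choice[x Hx] : forall k : nat, exists x : ('rV[R]_n -> R) * ('rV[R]_n -> R) * 'M[R]_n,
    [/\ K x.1.1 x.1.2, normalized L x.1.1, normalized L x.1.2 &
    [/\ symm x.2, forall h, - L * sq h <= quadv x.2 h,
      \tr x.2 <= s + k.+1%:R^-1 &
      forall h, sq h <= k.+1%:R -> x.1.1 h <= 2^-1 * quadv x.2 h]].
  move=> k; have k0 : (0 : R) < k.+1%:R by [].
  have i0 : (0 : R) < k.+1%:R^-1 by rewrite invr_gt0.
  have [_ [f [g [z [p [A [Kfg t ->]]]]]] lt] := inf_adherent i0 infT.
  have [f' [g' [Kfg' nf ng le]]] := blowup_touch K f g z p A _ Kc Kfg t k0.
  exists (f', g', A); split => //; split => //=; [by case: t| |exact: ltW].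
  have [p' [q [fp _ _]]] := K0 _ _ Kfg z.
  exact: touch_matrix_ge fp.1 t.
pose f_ k := (x k).1.1; pose g_ k := (x k).1.2; pose A_ k := (x k).2.
have Kf k : K (f_ k) (g_ k) by case: (Hx k).
have nf k : normalized L (f_ k) by case: (Hx k).
have ng k : normalized L (g_ k) by case: (Hx k).
have [f [g [ff gg _]]] : exists f g,
    [/\ fun_cvg U f_ f, fun_cvg U g_ g & split_contact_everywhere L f g].
  apply: split_contact_ultralimit => // z; exists (fun=> z); first exact: cvg_cst.
  by apply: filterE => k; exact: K0.
have [A AA] : exists A : 'M[R]_n, A_ @ U --> A.
  apply: (bounded_ultralimit_mx _ _ _ (3 * (`|s + 1| + n%:R * L + L))).
  apply: filterE => k i j; have [_ _ _ [sA lA tA _]] := Hx k.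
  apply: entry_bound_trace => //; first exact: ltW.
  by apply: (le_trans tA); rewrite lerD2l invf_le1// ler1n.
have sA : symm A by apply: (symm_limit U A_) => // k; case: (Hx k) => _ _ _ [].
have Kfg : K f g by apply: (K2 f_ g_).
have trA : \tr A <= s.
  have sk : (fun k => s + k.+1%:R^-1) @ U --> s.
    rewrite -[X in _ --> X]addr0; apply: cvgD; first exact: cvg_cst.
    by apply: cvg_ultrafilter; exact: cvg_harmonic.
  apply: (ler_cvg_to (cvg_trace _ _ _ AA) sk).
  by apply: filterE => k; case: (Hx k) => _ _ _ [].
exists f, g, A; split => //.
- exact: (normalized_limit _ _ f_).
- move=> z; apply: (@ler_cvg_to _ U _ _ (fun k => f_ k z) (fun k => 2^-1 * quadv (A_ k) z)).
  + exact: fun_cvg_pt.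
  + apply: cvgM; first exact: cvg_cst.
    by apply: cvg_quadv => //; exact: cvg_cst.
  apply: near_ultrafilter; near=> k; case: (Hx k) => _ _ _ [_ _ _]; apply.
  near: k; exists (Num.bound (sq z)) => // k /= zk.
  apply: ltW; apply: (lt_le_trans (archi_boundP (sq_ge0 z))).
  by rewrite ler_nat ltnW.
by move=> z p B t; apply: (le_trans trA); exact: (sT f g z p B Kfg t).
Unshelve. all: by end_near. Qed.

(** This replaces the almost everywhere second-order differentiability of convex
functions: rather than a point of differentiability, it provides a limit of
blow-ups that is a quadratic form. *)
Lemma blowup_quadratic K f0 g0 : blowup_class K -> K f0 g0 ->
  exists g A, symm A /\ K (fun z => 2^-1 * quadv A z) g.
Proof.
move=> Kc K00; have [f [g [A [Kfg nf sA fA tA]]]] := trace_minimizer K f0 g0 Kc K00.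
have [K0 _ _] := Kc.
have cf : continuous f.
  apply: (slope_continuous L) => // z.
  by have [p [q [? _ _]]] := K0 _ _ Kfg z; exists p.
have fE := strong_maximum f A cf sA fA (normalized0 L f nf) tA.
have {}fE : f = (fun z => 2^-1 * quadv A z) by apply/funext => z; exact: fE.
by exists g, A; split => //; rewrite -fE.
Qed.

End Rigidity.

(** * Touching matrices with almost nonpositive sum *)

Section Pairs.
Context {R : realType} {n : nat} (L : R) (L0 : 0 < L).
Context (U : set_system nat) {UU : UltraFilter U} (Uoo : \oo `<=` U).
Implicit Types (f g : 'rV[R]_n -> R) (p q z h w e : 'rV[R]_n) (A B : 'M[R]_n).

Lemma fun_cvg_unique (f_ : nat -> 'rV[R]_n -> R) f f' :
  fun_cvg U f_ f -> fun_cvg U f_ f' -> f = f'.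
Proof.
move=> ff ff'; apply/funext => z.
apply: (@cvg_unique _ (@Rhausdorff R) (fmap (fun k => f_ k z) U)).
  exact: fun_cvg_pt.
exact: fun_cvg_pt.
Qed.

Lemma split_contact_sym f g z p q : split_contact L f g z p q -> split_contact L g f z q p.
Proof.
by move=> [fp gq H]; split => // w; rewrite addrC (addrC (g z)) (addrC q).
Qed.

(** The negation of the conclusion of [touching_matrices], written with a strict bound so that
[touch_stable] makes it pass to limits. The points of contact [z] and [z'] are
unrelated: the two matrices alone matter, and they are invariant under
rescaling. *)
Definition touch_separated (d : R) f g := forall z z' p q A B (c : R),
  touch f z p A -> touch g z' q B -> c < d ->
  ~ (forall h, quadv A h + quadv B h <= c * sq h).

Lemma separated_blowup_class d : blowup_class L U
  (fun f g => split_contact_everywhere L f g /\ touch_separated d f g).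
Proof.
split=> [f g [] //|f g z0 r p q r0 [fg sep]|f_ g_ f g H nf ng ff gg].
- split=> [z|z z' p1 q1 A B c tA tB].
    have [p1 [q1 good1]] := fg (z0 + r *: z).
    exists (r^-1 *: (p1 - p)), (r^-1 *: (q1 - q)); exact: split_contact_rescale.
  exact: sep (touch_rescale _ _ _ _ _ _ _ r0 tA) (touch_rescale _ _ _ _ _ _ _ r0 tB).
split=> [|z z' p q A B c tA tB cd le].
  have [f' [g' [ff' gg' fg']]] : exists f g,
      [/\ fun_cvg U f_ f, fun_cvg U g_ g & split_contact_everywhere L f g].
    apply: split_contact_ultralimit => // z; exists (fun=> z); first exact: cvg_cst.
    by apply: filterE => k; exact: (H k).1.
  by rewrite (fun_cvg_unique _ _ _ ff ff') (fun_cvg_unique _ _ _ gg gg').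
pose e := (d - c) / 4; have e0 : 0 < e by rewrite /e; lra.
have cf k : continuous (f_ k).
  apply: (slope_continuous L) => // y.
  by have [p1 [q1 [? _ _]]] := (H k).1 y; exists p1.
have cg k : continuous (g_ k).
  apply: (slope_continuous L) => // y.
  by have [p1 [q1 [_ ? _]]] := (H k).1 y; exists q1.
have [r1 H1] := touch_stable _ _ _ _ _ _ _ ff cf tA e0.
have [r2 H2] := touch_stable _ _ _ _ _ _ _ gg cg tB e0.
have [k [[z1 [p1 [_ t1]]] [z2 [p2 [_ t2]]]]] := filter_ex (filterI H1 H2).
apply: ((H k).2 _ _ _ _ _ _ (c + 2 * e) t1 t2); first by rewrite /e; lra.
by move=> h; have := le h; rewrite !quadvDl !quadv_scalar; lra.
Qed.

Lemma quadratic_touch f a p A : symm A ->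
  (forall z, f z = a + dotv p z + 2^-1 * quadv A z) -> touch f 0 p A.
Proof.
move=> sA fE; split => //; exists 1 => // h _.
by rewrite add0r !fE dotv0r quadv0r; lra.
Qed.

(** Zooming in does not change the quadratic part of a quadratic polynomial, so the
second function of a pair can be treated without losing what was achieved for the
first one. The members are exchanged since [blowup_quadratic] acts on the first one. *)
Lemma quadratic_blowup_class K A : symm A -> blowup_class L U K ->
  blowup_class L U (fun g f => K f g /\
    exists a p, forall z, f z = a + dotv p z + 2^-1 * quadv A z).
Proof.
move=> sA [K0 K1 K2]; split.
- move=> g f [/K0 fg _] z; have [p [q pq]] := fg z; exists q, p; exact: split_contact_sym.
- move=> g f z0 r q p r0 [Kfg [a [p1 fE]]]; split; first exact: K1.
  exists 0, (r^-1 *: (p1 + z0 *m A - p)) => z.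
  rewrite /rescale !fE quadvD// quadvZr !dotvE.
  by field; rewrite gt_eqF.
move=> g_ f_ g f H ng nf gg ff.
have {}nf' k z : f_ k z = 2^-1 * quadv A z.
  have [a [p fE]] := (H k).2.
  have := normalized0 _ _ (nf k); rewrite fE dotv0r quadv0r mulr0 !addr0 => a0.
  have p0 := touch_slope L _ _ _ _ _ (normalized_slope _ _ (nf k)).1 (quadratic_touch _ _ _ _ sA fE).
  by rewrite fE a0 -p0 dotv0l !add0r.
split; first by apply: (K2 f_ g_) => // k; exact: (H k).1.
exists 0, 0 => z; rewrite dotv0l !add0r.
apply: (@cvg_unique _ (@Rhausdorff R) (fmap (fun k => f_ k z) U)).
  exact: fun_cvg_pt.
have -> : (fun k => f_ k z) = (fun=> 2^-1 * quadv A z) by apply/funext.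
exact: cvg_cst.
Qed.

(** If no such matrices exist, the pairs sharing this defect form a blow-up class.
Minimizing the trace for one member and then for the other yields in this class
a pair of quadratic polynomials. Their sum lies below an affine function that it
meets at the origin, so the sum of their matrices is nonpositive; but each
polynomial is touched by itself. *)
Theorem touching_matrices f g (d : R) : split_contact_everywhere L f g -> 0 < d ->
  exists z z' p q A B, [/\ touch f z p A, touch g z' q B &
    forall h, quadv A h + quadv B h <= d * sq h].
Proof.
move=> fg d0; apply: contrapT => no.
pose K f g := split_contact_everywhere L f g /\ touch_separated d f g.
have Kc : blowup_class L U K := separated_blowup_class d.
have K00 : K f g.
  split=> // z z' p q A B c tA tB cd le; apply: no.
  exists z, z', p, q, A, B; split => // h; apply: (le_trans (le h)).
  by rewrite ler_wpM2r ?sq_ge0// ltW.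
(* The first member becomes the form of [A], then the second one that of [B]. *)
have [g1 [A [sA K1]]] := blowup_quadratic L L0 U Uoo K f g Kc K00.
have K1' : K (fun z => 2^-1 * quadv A z) g1 /\ exists a p,
    forall z, 2^-1 * quadv A z = a + dotv p z + 2^-1 * quadv A z.
  by split => //; exists 0, 0 => z; rewrite dotv0l !add0r.
have [f2 [B [sB [[good2 sep2] [a [p f2E]]]]]] :=
  blowup_quadratic L L0 U Uoo _ _ _ (quadratic_blowup_class K A sA Kc) K1'.
have tA := quadratic_touch _ _ _ _ sA f2E.
have tB : touch (fun z => 2^-1 * quadv B z) 0 0 B.
  by apply: (quadratic_touch _ 0) => // z; rewrite dotv0l !add0r.
apply: (sep2 _ _ _ _ _ _ 0 tA tB d0) => h; rewrite mul0r.
have [p1 [q1 [_ _ H]]] := good2 0.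
have := H h; have := H (- h).
rewrite !f2E !subr0 !quadvN !dotvNr !dotv0r !quadv0r; lra.
Qed.

End Pairs.

(** * Images of expanding maps are not porous *)

Section Porosity.
Context {R : realType} {n : nat}.
Implicit Types (a x y z : 'rV[R]_n) (s t : R) (E : set 'rV[R]_n)
  (X : seq 'rV[R]_n).

(** Half-open cubes, so that subcubes do partition a cube. *)
Definition cube a s : set 'rV[R]_n :=
  [set x | forall i, a 0 i <= x 0 i < a 0 i + s].

Definition subcube_corner {m : nat} a s (d : {ffun 'I_n -> 'I_m}) : 'rV[R]_n :=
  \row_i (a 0 i + s / m%:R * (d i)%:R).

Definition subcube {m : nat} a s (d : {ffun 'I_n -> 'I_m}) :=
  cube (subcube_corner a s d) (s / m%:R).

Lemma cube_subcube (m : nat) a s x : (0 < m)%N -> 0 < s -> cube a s x ->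
  exists d : {ffun 'I_n -> 'I_m}, subcube a s d x.
Proof.
case: m => // m _ s0 ax; have m0 : (0 : R) < m.+1%:R by [].
pose y i := (x 0 i - a 0 i) * m.+1%:R / s.
have y0 i : 0 <= y i.
  by have /andP[? ?] := ax i; rewrite divr_ge0 ?(ltW s0)// mulr_ge0// subr_ge0.
have ym i : (Num.truncn (y i) < m.+1)%N.
  rewrite -(ltr_nat R); have /andP[+ _] := truncn_itv (y0 i).
  move=> /le_lt_trans; apply; rewrite ltr_pdivrMr// mulrC ltr_pM2l//.
  by have /andP[_] := ax i; rewrite ltrBlDl.
exists [ffun i => inord (Num.truncn (y i))] => i.
rewrite /subcube_corner mxE ffunE inordK//.
have -> : x 0 i = a 0 i + s / m.+1%:R * y i.
  by rewrite /y; field; rewrite !gt_eqF.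
have /andP[y1 y2] := truncn_itv (y0 i).
have sm : 0 < s / m.+1%:R by rewrite divr_gt0.
rewrite lerD2l -addrA ltrD2l ler_pM2l// y1/=.
by rewrite -[X in _ + X]mulr1 -mulrDr natr1 ltr_pM2l.
Qed.

Lemma cube_dist a s x y : 0 < s -> cube a s x -> cube a s y -> `|x - y| < s.
Proof.
move=> s0 ax ay; have [xy|xy] := eqVneq (x - y) 0; first by rewrite xy normr0.
have [[i j] /= E] := mx_norm_neq0 (contra_not_neq (@mx_norm_eq0 _ _ _ (x - y)) (elimN eqP xy)).
rewrite [`|x - y|]E (ord1 i) !mxE ltr_norml.
by have /andP[? ?] := ax j; have /andP[? ?] := ay j; apply/andP; split; lra.
Qed.

Lemma subcube_dist (m : nat) a s (d : {ffun 'I_n -> 'I_m}) x y : (0 < m)%N ->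
  0 < s -> subcube a s d x -> subcube a s d y -> `|x - y| < s / m%:R.
Proof. by move=> m0 s0; apply: cube_dist; rewrite divr_gt0// ltr0n. Qed.

Definition separated t X :=
  uniq X /\ {in X &, forall x y, x != y -> t <= `|x - y|}.

Lemma size_subcubes (m : nat) a s X : (0 < m)%N -> 0 < s ->
  {in X, forall x, cube a s x} ->
  (size X <= \sum_(d : {ffun 'I_n -> 'I_m})
     size [seq x <- X | `[< subcube a s d x >]])%N.
Proof.
move=> m0 s0; elim: X => [//|x X IH] H.
have [d xd] := cube_subcube m a s x m0 s0 (H x (mem_head _ _)).
have {}IH : (size X <= \sum_(d : {ffun 'I_n -> 'I_m})
     size [seq x <- X | `[< subcube a s d x >]])%N.
  by apply: IH => y yX; apply: H; rewrite in_cons yX orbT.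
rewrite (bigD1 d)//= asboolT//= addSn ltnS.
apply: (leq_trans IH); rewrite [leqLHS](bigD1 d)//= leq_add2l.
by apply: leq_sum => e _; case: ifP => //= _; exact: leqnSn.
Qed.

Lemma separated_filter t X (P : pred 'rV[R]_n) :
  separated t X -> separated t [seq x <- X | P x].
Proof.
move=> [uX sX]; split; first exact: filter_uniq.
by move=> x y; rewrite !mem_filter => /andP[_ xX] /andP[_ yX]; exact: sX.
Qed.

(** In each cube of side at most [s0] one of the [m ^ n] subcubes contains no point of
[E], so the number of separated points that fit into a cube is multiplied by at most
[m ^ n - 1] from one scale to the next. At the last scale half-open cubes contain
at most one of the points. *)
Lemma porous_packing (m : nat) E (s0 : R) : (0 < m)%N ->
  (forall a s, 0 < s <= s0 -> exists d : {ffun 'I_n -> 'I_m},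
     forall x, E x -> ~ subcube a s d x) ->
  forall j a s X, 0 < s <= s0 -> {in X, forall x, E x /\ cube a s x} ->
  separated (s / m%:R ^+ j) X -> (size X <= ((m ^ n).-1 ^ j))%N.
Proof.
move=> m0 hole; have mR : 0 < m%:R :> R by rewrite ltr0n.
elim=> [|j IH] a s X s1 XE sX.
  have [s00 _] := andP s1.
  case: X XE sX => [//|x [//|y X]] XE [/= /andP[nx _] sX]; exfalso.
  have xy : x != y by apply: contraNN nx => /eqP ->; exact: mem_head.
  have xX : x \in [:: x, y & X] by rewrite mem_head.
  have yX : y \in [:: x, y & X] by rewrite in_cons mem_head orbT.
  have := sX _ _ xX yX xy; rewrite expr0 divr1 leNgt.
  by rewrite (cube_dist a s)//; [case: (XE _ xX)|case: (XE _ yX)].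
have [s00 ss0] := andP s1; have [d0 Hd0] := hole a s s1.
apply: (leq_trans (size_subcubes m a s X m0 s00 (fun x xX => (XE x xX).2))).
rewrite (bigD1 d0)//= (_ : size _ = 0)%N ?add0n; last first.
  apply/eqP; rewrite size_filter -leqn0 leqNgt -has_count -all_predC.
  by apply/allP => x xX /=; apply/asboolPn; apply: Hd0; case: (XE x xX).
apply: (@leq_trans (\sum_(d : {ffun 'I_n -> 'I_m} | d != d0) (m ^ n).-1 ^ j)%N).
  apply: leq_sum => d _; apply: (IH (subcube_corner a s d) (s / m%:R)).
  - rewrite divr_gt0//= ler_pdivrMr//; apply: (le_trans ss0).
    by rewrite ler_peMr ?ler1n// (le_trans _ ss0)// ltW.
  - by move=> x; rewrite mem_filter => /andP[/asboolP xd /XE[]].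
  - apply: separated_filter.
    by have -> : s / m%:R / m%:R ^+ j = s / m%:R ^+ j.+1 by rewrite exprS invfM mulrA.
rewrite sum_nat_const expnS leq_mul2r; apply/orP; right.
have := cardC1 d0; rewrite card_ffun !card_ord => <-.
by apply: eq_leq; apply: eq_card.
Qed.

Lemma packing_refine (m : nat) E t (K : nat) : (0 < m)%N ->
  forall b s, 0 < s ->
  (forall a X, {in X, forall x, E x /\ cube a (s / m%:R ^+ b) x} ->
    separated t X -> (size X <= K)%N) ->
  forall a X, {in X, forall x, E x /\ cube a s x} -> separated t X ->
  (size X <= (m ^ n) ^ b * K)%N.
Proof.
move=> m0; have mR : 0 < m%:R :> R by rewrite ltr0n.
elim=> [|b IH] s s0 H a X XE sX.
  by rewrite expn0 mul1n (H a X)// expr0 divr1.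
apply: (leq_trans (size_subcubes m a s X m0 s0 (fun x xX => (XE x xX).2))).
apply: (@leq_trans (\sum_(d : {ffun 'I_n -> 'I_m}) (m ^ n) ^ b * K)%N).
  apply: leq_sum => d _; apply: (IH (s / m%:R) _ _ (subcube_corner a s d)).
  - by rewrite divr_gt0.
  - by move=> a' X'; rewrite -mulrA -invfM -exprS; exact: H.
  - by move=> x; rewrite mem_filter => /andP[/asboolP xd /XE[]].
  - exact: separated_filter.
by rewrite sum_nat_const card_ffun !card_ord expnS mulnA.
Qed.

(** Bernoulli's inequality: [(M / M.-1) ^ k] grows at least linearly in [k]. *)
Lemma expn_gap (M C : nat) : (0 < M)%N -> exists k, (C * M.-1 ^ k < M ^ k)%N.
Proof.
case: M => // P _ /=; case: P => [|P]; first by exists 1%N; rewrite expn1 muln0.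
have gap k : (P.+1 ^ k * (P.+1 + k) <= P.+1 * P.+2 ^ k)%N.
  elim: k => [|k IH]; first by rewrite !expn0 addn0 mul1n muln1.
  apply: (@leq_trans (P.+1 ^ k * (P.+1 + k) * P.+2)%N).
    by rewrite expnS; nia.
  by rewrite expnS [(P.+2 * _)%N]mulnC mulnA leq_mul2r IH orbT.
exists (C * P.+1).+1; move kE : (C * P.+1).+1 => k; rewrite ltnNge; apply/negP => le.
have := leq_trans (gap k) (leq_mul (leqnn P.+1) le).
have pk : (0 < P.+1 ^ k)%N by rewrite expn_gt0.
by rewrite mulnA [(_ * P.+1 ^ k)%N]mulnC leq_pmul2l//; nia.
Qed.

(** Separation forces [E] to fill some small cube at the finer scale: otherwise
the packing numbers of [E] would grow like [(m ^ n - 1) ^ k] only, whereas the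
points [X q] with [q] on finer and finer grids yield packings that grow like
[(m ^ n) ^ k]. *)
Lemma expanding_fills_cube E (X : 'rV[R]_n -> 'rV[R]_n) (D c rho : R) (m : nat)
    (s0 : R) :
  0 < D -> 0 < c -> 0 < rho -> (1 < m)%N -> 0 < s0 ->
  (forall x, E x -> `|x| <= D) ->
  (forall q, `|q| <= rho -> E (X q)) ->
  (forall p q, `|p| <= rho -> `|q| <= rho ->
    c * sq (p - q) <= sq (X p - X q)) ->
  exists a s, 0 < s <= s0 /\ forall d : {ffun 'I_n -> 'I_m},
    exists2 x, E x & subcube a s d x.
Proof.
move=> D0 c0 rho0 m1 s00 ED EX Xc; apply: contrapT => no.
have m0 : (0 < m)%N by exact: ltnW.
have mR : 0 < m%:R :> R by rewrite ltr0n.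
have mk k : 0 < m%:R ^+ k :> R by rewrite exprn_gt0.
have hole a s : 0 < s <= s0 -> exists d : {ffun 'I_n -> 'I_m},
    forall x, E x -> ~ subcube a s d x.
  move=> s1; apply: contrapT => full; apply: no; exists a, s; split => // d.
  apply: contrapT => none; apply: full; exists d => x Ex dx.
  by apply: none; exists x.
pose S := 2 * D + 1; have S0 : 0 < S by rewrite /S; lra.
have large (A : R) : exists k, A <= m%:R ^+ k.
  exists (Num.bound `|A|); apply: (le_trans (ler_norm A)).
  apply: (le_trans (ltW (archi_boundP (normr_ge0 A)))).
  by rewrite -natrX ler_nat ltnW// ltn_expl.
(* After [b] subdivisions the cubes have side at most [s0]; the [b'] extra ones absorb
   the constants that compare the mesh of the grid to the distances of the images. *)
have [b Hb] := large (S / s0).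
have [b' Hb'] := large (n%:R * S ^+ 2 / (c * rho ^+ 2)).
have Sb : 0 < S / m%:R ^+ b <= s0.
  by rewrite divr_gt0//= ler_pdivrMr// mulrC -ler_pdivrMr.
have M0 : (0 < m ^ n)%N by rewrite expn_gt0 m0.
have [k Hk] := expn_gap (m ^ n) ((m ^ n) ^ b * (m ^ n).-1 ^ b') M0.
pose grid (i : {ffun 'I_n -> 'I_(m ^ k)}) : 'rV[R]_n :=
  \row_l (rho / m%:R ^+ k * (i l)%:R).
have grid_rho i : `|grid i| <= rho.
  apply: norm_le_coord; first exact: ltW.
  move=> l; rewrite mxE ger0_norm; last by rewrite mulr_ge0// divr_ge0// ltW.
  rewrite mulrAC ler_pdivrMr// ler_wpM2l ?(ltW rho0)//.
  by rewrite -natrX ler_nat ltnW.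
have grid_sep i j : i != j -> (rho / m%:R ^+ k) ^+ 2 <= sq (grid i - grid j).
  move=> ij; have [l il] : exists l, i l != j l.
    apply/existsP; apply: contraNT ij => /existsPn H; apply/eqP/ffunP => l.
    by apply/eqP; rewrite -[_ == _]negbK H.
  apply: le_trans (coord_sq_le _ l); rewrite !mxE -mulrBr [leRHS]exprMn ler_peMr//.
    by rewrite exprn_ge0// divr_ge0// ltW.
  have H (u v : nat) : (u < v)%N -> (1 : R) <= (u%:R - v%:R) ^+ 2.
    move=> uv; have : u%:R + 1 <= v%:R :> R by rewrite natr1 ler_nat.
    by nra.
  move: il; rewrite -val_eqE/= neq_ltn => /orP[|] /H //.
  by rewrite -sqrrN opprB.
pose t := S / m%:R ^+ b / m%:R ^+ (k + b').
have t0 : 0 < t by rewrite !divr_gt0.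
have Xsep i j : i != j -> t <= `|X (grid i) - X (grid j)|.
  move=> ij; rewrite leNgt; apply/negP => lt.
  have := Xc _ _ (grid_rho i) (grid_rho j); have := sq_le_norm (X (grid i) - X (grid j)).
  move: lt; set N := `|_| => lt a1 a2.
  have a3 : c * (rho / m%:R ^+ k) ^+ 2 <= n%:R * N ^+ 2.
    by apply: le_trans (le_trans a2 a1); rewrite ler_pM2l// grid_sep.
  have rk : 0 < (rho / m%:R ^+ k) ^+ 2 by rewrite exprn_gt0// divr_gt0.
  have n0 : 0 < n%:R :> R.
    rewrite lt_neqAle ler0n andbT; apply/eqP => n0.
    by move: a3; rewrite -n0 mul0r leNgt mulr_gt0.
  have a4 : n%:R * N ^+ 2 < n%:R * t ^+ 2.
    by rewrite ltr_pM2l// ltr_pXn2r// nnegrE ?(ltW t0)//; exact: normr_ge0.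
  have := le_lt_trans a3 a4; rewrite ltNge => /negP; apply.
  have -> : n%:R * t ^+ 2 =
      n%:R * S ^+ 2 / (m%:R ^+ b * m%:R ^+ k * m%:R ^+ b') ^+ 2.
    by rewrite /t exprD; field; rewrite !gt_eqF.
  have -> : c * (rho / m%:R ^+ k) ^+ 2 =
      c * rho ^+ 2 * (m%:R ^+ b * m%:R ^+ b') ^+ 2 /
      (m%:R ^+ b * m%:R ^+ k * m%:R ^+ b') ^+ 2.
    by field; rewrite !gt_eqF.
  rewrite ler_pM2r ?invr_gt0 ?exprn_gt0 ?mulr_gt0//.
  move: Hb'; rewrite ler_pdivrMr; last by rewrite mulr_gt0// exprn_gt0.
  move=> /le_trans; apply; rewrite mulrC ler_pM2l; last by rewrite mulr_gt0// exprn_gt0.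
  have mge j' : (1 : R) <= m%:R ^+ j' by rewrite exprn_ege1// ler1n.
  have := mge b; have := mge b'; set u := m%:R ^+ b; set v := m%:R ^+ b' => v1 u1.
  have uv : v <= u * v by rewrite ler_peMl// (le_trans _ v1).
  by apply: (le_trans uv); rewrite expr2 ler_peMl// (le_trans _ uv)// (le_trans _ v1).
pose Q := [seq X (grid i) | i <- enum {ffun 'I_n -> 'I_(m ^ k)}].
have Xinj i j : X (grid i) = X (grid j) -> i = j.
  move=> E'; apply/eqP; apply: contraT => /Xsep.
  by rewrite E' subrr normr0 leNgt t0.
have szQ : size Q = ((m ^ n) ^ k)%N.
  by rewrite size_map -cardE card_ffun !card_ord -!expnM mulnC.
have sQ : separated t Q.
  split; first by rewrite map_inj_uniq ?enum_uniq//; move=> i j; exact: Xinj.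
  move=> _ _ /mapP[i _ ->] /mapP[j _ ->] ij; apply: Xsep.
  by apply: contraNneq ij => ->.
pose a0 : 'rV[R]_n := const_mx (- D).
have QE : {in Q, forall x, E x /\ cube a0 S x}.
  move=> _ /mapP[i _ ->]; have Ex := EX _ (grid_rho i); split => // l.
  have := le_trans (norm_coord_le _ l) (ED _ Ex).
  by rewrite mxE ler_norml /S => /andP[? ?]; apply/andP; split; lra.
have := @packing_refine m E t ((m ^ n).-1 ^ (k + b')) m0 b S S0 _ a0 Q QE sQ.
rewrite szQ => le; move: Hk; rewrite ltnNge => /negP; apply.
rewrite -mulnA -expnD addnC; apply: le => a P PE sP.
exact: (porous_packing m E s0 m0 hole _ a (S / m%:R ^+ b)).
Qed.

(** In the middle of a cube filled by [E], the set [E] is relatively dense at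
the scale of the cube. *)
Lemma expanding_dense_scale E (X : 'rV[R]_n -> 'rV[R]_n) (D c rho N e : R) :
  0 < D -> 0 < c -> 0 < rho -> 0 <= N -> 0 < e ->
  (forall x, E x -> `|x| <= D) ->
  (forall q, `|q| <= rho -> E (X q)) ->
  (forall p q, `|p| <= rho -> `|q| <= rho ->
    c * sq (p - q) <= sq (X p - X q)) ->
  exists x r, [/\ E x, 0 < r, r <= e & forall z, `|z| <= N ->
    exists2 y, E y & `|x + r *: z - y| <= r * e].
Proof.
move=> D0 c0 rho0 N0 e0 ED EX Xc.
pose mu := (Num.bound (3 * (N + 1) / e)).+1.
pose m := (2 * mu).+1.
have [a [s [/andP[s0 se] full]]] :=
  expanding_fills_cube E X D c rho m e D0 c0 rho0 isT e0 ED EX Xc.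
have mR : 0 < m%:R :> R by [].
have N1 : 0 < 3 * (N + 1) by lra.
have mu_lt : (mu < m)%N by rewrite /m; lia.
have [x Ex xa] := full [ffun=> Ordinal mu_lt].
exists x, (s / (3 * (N + 1))).
have r0 : 0 < s / (3 * (N + 1)) by rewrite divr_gt0.
split => //.
  rewrite ler_pdivrMr// (le_trans se)// ler_peMr ?(ltW e0)//; lra.
move=> z zN; set r := s / _ in r0 *.
have third : m%:R <= 3 * mu%:R :> R.
  by rewrite -natrM ler_nat /m /mu; lia.
have mmu : m%:R = 2 * mu%:R + 1 :> R by rewrite /m -natr1 natrM.
have cz : cube a s (x + r *: z).
  move=> i; have := xa i; rewrite !mxE ffunE /=.
  have zr : `|r * z 0 i| <= s / 3.
    rewrite normrM gtr0_norm// (_ : s / 3 = r * (N + 1)); last first.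
      by rewrite /r; field; rewrite gt_eqF//; lra.
    rewrite ler_pM2l// (le_trans (norm_coord_le z i))// (le_trans zN)//; lra.
  have s3 : s / 3 <= s / m%:R * mu%:R.
    rewrite -mulrA ler_pM2l// ler_pdivlMl//; lra.
  have sm : s = s / m%:R * (2 * mu%:R + 1).
    by rewrite -mmu divfK// gt_eqF.
  move: zr; rewrite ler_norml => /andP[? ?] /andP[? ?].
  apply/andP; split; lra.
have [d dz] := cube_subcube m a s _ isT s0 cz.
have [y Ey ya] := full d; exists y => //.
have := subcube_dist m a s d _ _ isT s0 dz ya => /ltW /le_trans; apply.
have me : 3 * (N + 1) <= m%:R * e.
  rewrite -ler_pdivrMr//; apply: (@le_trans _ _ (Num.bound (3 * (N + 1) / e))%:R).
    by apply: ltW; apply: archi_boundP; rewrite divr_ge0// ltW.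
  by rewrite ler_nat /m /mu; lia.
have rE : r * e * m%:R = s * ((m%:R * e) / (3 * (N + 1))).
  by rewrite /r; field; rewrite gt_eqF//; lra.
by rewrite ler_pdivrMr// rE ler_peMr ?(ltW s0)// ler_pdivlMr// mul1r.
Qed.

End Porosity.

(** * Touching near contact points of a sum *)

Section Sums.
Context {R : realType} {n : nat} (L : R) (L0 : 0 < L).
Implicit Types (f g : 'rV[R]_n -> R) (p q x y z h w e : 'rV[R]_n) (A B : 'M[R]_n).

Definition contact f g x q := forall y,
  f y + g y <= f x + g x + dotv q (y - x).

(** Each function lies below the affine function minus the lower paraboloid of the
other one, hence is squeezed at [x], and its slope is unique. *)
Lemma contact_split f g x p p' q : slope_below L f x p -> slope_below L g x p' ->
  contact f g x q -> p + p' = q /\ split_contact L f g x p p'.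
Proof.
move=> fp gp xq.
have up (a b : 'rV[R]_n -> R) s : (forall y, a y + b y <= a x + b x + dotv q (y - x)) ->
    slope_below L b x s -> slope_above L a x (q - s).
  move=> ab bs y; have := ab y; have := bs y; rewrite dotvDl dotvNl; lra.
have fa := up f g p' xq gp.
have ga : slope_above L g x (q - p).
  by apply: (up g f) => // y; rewrite addrC (addrC (g x)).
have touch_above (a : 'rV[R]_n -> R) s : slope_above L a x s -> touch a x s L%:M.
  move=> sa; split; first exact: symm_scalar.
  exists 1 => // h _; have := sa (x + h).
  by rewrite [x + h - x]addrAC subrr add0r quadv_scalar mulrA; lra.
have pE := touch_slope _ _ _ _ _ _ fp (touch_above _ _ fa).
have pq : p + p' = q by rewrite pE subrK.
split=> //; split.
- by split=> //; rewrite pE.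
- by split=> //; rewrite (_ : p' = q - p)// -pq addrAC subrr add0r.
- by move=> w; rewrite pq; exact: xq.
Qed.

(** Since the gradients of both functions are Lipschitz on the set of contact points, a
small set of contact points only produces a small set of slopes. This is the
substitute for the area formula in Jensen's lemma. *)
Lemma contact_expanding f g x1 x2 q1 q2 :
  (forall z, exists p, slope_below L f z p) ->
  (forall z, exists p, slope_below L g z p) ->
  contact f g x1 q1 -> contact f g x2 q2 ->
  (36 * L ^+ 2)^-1 * sq (q1 - q2) <= sq (x1 - x2).
Proof.
move=> bf bg c1 c2.
have [p1 fb1] := bf x1; have [p1' gb1] := bg x1.
have [p2 fb2] := bf x2; have [p2' gb2] := bg x2.
have [<- [fp1 gp1 _]] := contact_split _ _ _ _ _ _ fb1 gb1 c1.
have [<- [fp2 gp2 _]] := contact_split _ _ _ _ _ _ fb2 gb2 c2.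
have := slope_lipschitz _ _ _ _ _ _ L0 fp1 fp2.
have := slope_lipschitz _ _ _ _ _ _ L0 gp1 gp2.
have := sqD_le (p1 - p2) (p1' - p2').
rewrite opprD addrACA ler_pdivrMl ?mulr_gt0 ?exprn_gt0//; lra.
Qed.

(** Contact points with arbitrarily small slopes are dense at some small scale around
one of them, by [contact_expanding] and [expanding_dense_scale]. Rescaled there, [f] and [g]
converge to a pair to which [touching_matrices] applies, and the touching
paraboloids are carried back by [touch_stable]. *)
Theorem contact_touching f g (D e : R) : 0 < D -> 0 < e ->
  continuous f -> continuous g ->
  (forall z, exists p, slope_below L f z p) ->
  (forall z, exists p, slope_below L g z p) ->
  (forall q, `|q| <= 1 -> exists2 x, `|x| <= D & contact f g x q) ->
  exists x q x1 p1 A x2 p2 B,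
    [/\ `|x| <= D, `|q| <= e & contact f g x q] /\
    [/\ `|x1 - x| <= e, `|x2 - x| <= e, touch f x1 p1 A, touch g x2 p2 B &
      forall h, quadv A h + quadv B h <= e * sq h].
Proof.
move=> D0 e0 cf cg bf bg Hx.
have [U [UU Uoo]] := ultraFilterLemma eventually_filter.
have /choice[X HX] : forall q, exists x,
    `|q| <= 1 -> `|x| <= D /\ contact f g x q.
  move=> q; have [q1|q1] := pselect (`|q| <= 1); last by exists 0.
  by have [x xD xq] := Hx q q1; exists x.
pose E k := [set x | `|x| <= D /\ exists2 q, `|q| <= k.+1%:R^-1 & contact f g x q].
have k0 k : (0 : R) < k.+1%:R^-1 by rewrite invr_gt0.
have k1 k : k.+1%:R^-1 <= 1 :> R by rewrite invf_le1// ler1n.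
have /choice[xr Hxr] : forall k : nat, exists xr : 'rV[R]_n * R,
    [/\ E k xr.1, 0 < xr.2, xr.2 <= k.+1%:R^-1 & forall z, `|z| <= k.+1%:R ->
    exists2 y, E k y & `|xr.1 + xr.2 *: z - y| <= xr.2 * k.+1%:R^-1].
  move=> k.
  have [x [r [? ? ? ?]]] := @expanding_dense_scale R n (E k) X D
    (36 * L ^+ 2)^-1 k.+1%:R^-1 k.+1%:R k.+1%:R^-1 D0
    ltac:(by rewrite invr_gt0 mulr_gt0// exprn_gt0) (k0 k) (ler0n _ _) (k0 k)
    (fun x xE => xE.1)
    (fun q qk => conj (HX q (le_trans qk (k1 k))).1
      (ex_intro2 _ _ q qk (HX q (le_trans qk (k1 k))).2))
    (fun p q pk qk => contact_expanding _ _ _ _ _ _ bf bg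
      (HX p (le_trans pk (k1 k))).2 (HX q (le_trans qk (k1 k))).2).
  by exists (x, r).
have Egood k y : E k y -> exists p p', split_contact L f g y p p'.
  move=> [_ [q _ yq]]; have [p fp] := bf y; have [p' gp] := bg y.
  by exists p, p'; have [] := contact_split _ _ _ _ _ _ fp gp yq.
have /choice[pp Hpp] : forall k, exists pp : 'rV[R]_n * 'rV[R]_n,
    split_contact L f g (xr k).1 pp.1 pp.2.
  move=> k; have [Ek _ _ _] := Hxr k.
  by have [p [p' ?]] := Egood _ _ Ek; exists (p, p').
pose f_ k := rescale f (xr k).1 (xr k).2 (pp k).1.
pose g_ k := rescale g (xr k).1 (xr k).2 (pp k).2.
have r0 k : 0 < (xr k).2 by case: (Hxr k).
(* The blow-up limit of both functions around the points [(xr k).1]. *)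
have [f' [g' [ff gg fg]]] : exists f g,
    [/\ fun_cvg U f_ f, fun_cvg U g_ g & split_contact_everywhere L f g].
  apply: split_contact_ultralimit => // [k|k|z].
  - by apply: rescale_normalized => //; case: (Hpp k).
  - by apply: rescale_normalized => //; case: (Hpp k).
  have /choice[z_ Hz] : forall k, exists z', `|z - z'| <= k.+1%:R^-1 /\
      (`|z| <= k.+1%:R -> exists p q, split_contact L (f_ k) (g_ k) z' p q).
    move=> k; have [zk|zk] := pselect (`|z| <= k.+1%:R); last first.
      by exists z; split => //; rewrite subrr normr0 ltW.
    have [_ _ _ H] := Hxr k; have [y Ey yz] := H z zk.
    have rn : (xr k).2 != 0 by rewrite gt_eqF.
    have yE : (xr k).1 + (xr k).2 *: ((xr k).2^-1 *: (y - (xr k).1)) = y.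
      by rewrite scalerA divff// scale1r addrC subrK.
    exists ((xr k).2^-1 *: (y - (xr k).1)); split => [|_].
      rewrite -(ler_pM2l (r0 k)) -[X in X * `|_|]gtr0_norm// -normrZ.
      apply: le_trans yz; rewrite scalerBr scalerA divff// scale1r.
      by rewrite opprB addrCA addrA.
    have [p [p' gd]] := Egood _ _ Ey.
    exists ((xr k).2^-1 *: (p - (pp k).1)), ((xr k).2^-1 *: (p' - (pp k).2)).
    by apply: split_contact_rescale => //; rewrite yE.
  exists z_.
    apply/cvgrPdist_le => d d0; apply: near_ultrafilter => //.
    have : (fun k => k.+1%:R^-1 : R) @ \oo --> (0 : R) by exact: cvg_harmonic.
    move=> /cvgrPdist_le /(_ d d0); apply: filterS => k.
    rewrite sub0r normrN gtr0_norm// => kd.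
    by apply: (le_trans _ kd); case: (Hz k).
  apply: near_ultrafilter => //; exists (Num.bound `|z|) => // k /= zk.
  apply: (Hz k).2; apply: ltW; apply: (lt_le_trans (archi_boundP (normr_ge0 z))).
  by rewrite ler_nat ltnW.
have crescale (a : 'rV[R]_n -> R) y r p : continuous a -> continuous (rescale a y r p).
  move=> ca h; have FF : Filter (nbhs h) := nbhs_filter h.
  have h1 : (fun k => y + r *: k) @ nbhs h --> y + r *: h.
    by apply: cvgD; [exact: cvg_cst|apply: cvgZr; exact: cvg_id].
  apply: cvgM; last exact: cvg_cst.
  apply: cvgB; last first.
    apply: cvgM; first exact: cvg_cst.
    by apply: cvg_dotv; [exact: cvg_cst|exact: cvg_id].
  apply: cvgB; last exact: cvg_cst.
  exact: (@continuous_cvg _ _ _ _ FF _ a _ (ca _) h1).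
have e2 : 0 < e / 2 by rewrite divr_gt0.
have e4 : 0 < e / 4 by rewrite divr_gt0.
have [z [z' [p [q [A [B [tA tB AB]]]]]]] := touching_matrices L L0 U Uoo f' g' (e / 2) fg e2.
have [c1 H1] := touch_stable _ f_ _ _ _ _ _ ff (fun k => crescale _ _ _ _ cf) tA e4.
have [c2 H2] := touch_stable _ g_ _ _ _ _ _ gg (fun k => crescale _ _ _ _ cg) tB e4.
have bnd (y y' : 'rV[R]_n) c : sq (y' - y) <= c -> `|y'| <= 2 * `|c| + 2 * sq y + 1.
  move=> yc; have := sqD_le (y' - y) y; rewrite subrK => a1.
  have := norm_sq_le y'; have := ler_norm c; set t := `|y'| => a2 a3.
  by have := sqr_ge0 (t - 2^-1); rewrite sqrrB; lra.
pose Z := 1 + (2 * `|c1| + 2 * sq z + 1) + (2 * `|c2| + 2 * sq z' + 1).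
have Z1 : 1 + (2 * `|c1| + 2 * sq z + 1) <= Z.
  by have := sq_ge0 z'; have := normr_ge0 c2; rewrite /Z; lra.
have Z2 : 1 + (2 * `|c2| + 2 * sq z' + 1) <= Z.
  by have := sq_ge0 z; have := normr_ge0 c1; rewrite /Z; lra.
have Z0 : 1 <= Z by have := sq_ge0 z'; have := normr_ge0 c2; lra.
have H3 : \forall k \near U, k.+1%:R^-1 * Z <= e.
  apply: near_ultrafilter => //; exists (Num.bound (Z / e)) => // k /= zk.
  rewrite mulrC ler_pdivrMr// mulrC -ler_pdivrMr//.
  apply: ltW; apply: lt_le_trans (archi_boundP _) _; last by rewrite ler_nat ltnW.
  by rewrite divr_ge0// ltW// (lt_le_trans ltr01).
have [k [[z1 [p1 [a1 t1]]] [[z2 [p2 [a2 t2]]] kZ]]] := filter_ex (filterI H1 (filterI H2 H3)).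
have [[xD [qk qk1 xq]] _ rk _] := Hxr k.
have small (y : 'rV[R]_n) : `|y| <= Z -> `|(xr k).1 + (xr k).2 *: y - (xr k).1| <= e.
  move=> yZ; rewrite addrAC subrr add0r normrZ gtr0_norm//.
  by apply: le_trans kZ; apply: ler_pM => //; exact: ltW.
exists (xr k).1, qk, ((xr k).1 + (xr k).2 *: z1), ((pp k).1 + (xr k).2 *: p1), (A + (e / 4)%:M),
  ((xr k).1 + (xr k).2 *: z2), ((pp k).2 + (xr k).2 *: p2), (B + (e / 4)%:M).
split; split => //.
- apply: (le_trans qk1); apply: le_trans kZ.
  by rewrite ler_peMr// ltW.
- by apply: small; have := bnd _ _ _ a1; lra.
- by apply: small; have := bnd _ _ _ a2; lra.
- exact: touch_rescale.
- exact: touch_rescale.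
- by move=> h; have := AB h; rewrite !quadvDl !quadv_scalar; lra.
Qed.

End Sums.

(** * Sup-convolutions *)

Section SupConvolution.
Context {R : realType} {n : nat}.
Implicit Types (f g u : 'rV[R]_n -> R) (p q x y z h w e : 'rV[R]_n) (A B : 'M[R]_n)
  (K Omega : set 'rV[R]_n).

(** The function [arg] chooses a point where the supremum over the compact set [K] is
attained. *)
Definition sup_convolution (L : R) K u f (arg : 'rV[R]_n -> 'rV[R]_n) :=
  forall x, [/\ K (arg x), f x = u (arg x) - L / 2 * sq (x - arg x) &
    forall y, K y -> u y - L / 2 * sq (x - y) <= f x].

Lemma within_cvg {T : Type} (F : set_system T) {FF : Filter F} K
    {V : topologicalType} (u : 'rV[R]_n -> V) (y_ : T -> 'rV[R]_n) y :
  {within K, continuous u} -> K y -> (\forall k \near F, K (y_ k)) ->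
  y_ @ F --> y -> u (y_ k) @[k --> F] --> u y.
Proof.
move=> /subspace_continuousP cu Ky Ky_ yy B Bu.
have := cu y Ky B Bu; rewrite /within /= => /yy.
by apply: filterS2 Ky_ => k Kk; exact.
Qed.

Lemma sup_convolution_exists (L : R) K u : K !=set0 -> compact K ->
  {within K, continuous u} -> exists f arg, sup_convolution L K u f arg.
Proof.
move=> K0 cK cu.
have H x : exists y, K y /\ forall w, K w ->
    u w - L / 2 * sq (x - w) <= u y - L / 2 * sq (x - y).
  have cw : {within K, continuous (fun w => u w - L / 2 * sq (x - w))}.
    apply/subspace_continuousP => y Ky.
    have FF : Filter (within K (nbhs y)) by exact: within_filter.
    have idw : id @ within K (nbhs y) --> y by exact: cvg_within.
    apply: cvgB; first by move/subspace_continuousP : cu; exact.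
    apply: cvgM; first exact: cvg_cst.
    by apply: cvg_sq; apply: cvgB => //; exact: cvg_cst.
  have [y] := compact_EVT_max K0 cK cw.
  by rewrite inE => Ky Hy; exists y; split => // w Kw; apply: Hy; rewrite inE.
have [arg Harg] := choice H.
exists (fun x => u (arg x) - L / 2 * sq (x - arg x)), arg => x.
by have [? ?] := Harg x; split.
Qed.

Section Properties.
Context (L : R) (K : set 'rV[R]_n) (u f : 'rV[R]_n -> R)
  (arg : 'rV[R]_n -> 'rV[R]_n).
Context (L0 : 0 < L) (uf : sup_convolution L K u f arg).

(** The paraboloid with vertex [y] lies below [f] and meets it at [x]. The point [y]
need not be [arg x]: limits of maximizers are maximizers as well. *)
Lemma maximizer_slope_below x y : K y -> f x = u y - L / 2 * sq (x - y) ->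
  slope_below L f x (L *: (y - x)).
Proof.
move=> Ky fx z; have [_ _ /(_ y Ky)] := uf z; rewrite fx dotvZl.
have -> : z - y = (z - x) + (x - y) by rewrite addrA subrK.
rewrite (sqD (z - x)); have -> : dotv (y - x) (z - x) = - dotv (z - x) (x - y).
  by rewrite -dotvNr opprB dotvC.
lra.
Qed.

Lemma sup_convolution_slope_below x : slope_below L f x (L *: (arg x - x)).
Proof. by have [? ? _] := uf x; exact: maximizer_slope_below. Qed.

Lemma sup_convolution_continuous (Y : R) : (forall y, K y -> sq y <= Y) ->
  continuous f.
Proof.
move=> KY; apply: (@slope_below_continuous _ _ L _ (2 * L ^+ 2 * (`|Y| + 1))) => x.
exists (L *: (arg x - x)); first exact: sup_convolution_slope_below.
have [Ka _ _] := uf x; have := KY _ Ka; have := ler_norm Y => a1 a2.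
have := sqD_le (arg x) (- x); rewrite sqN sqZ => a3.
have -> : 2 * L ^+ 2 * (`|Y| + 1) * (sq x + 1) =
    L ^+ 2 * (2 * ((`|Y| + 1) * (sq x + 1))) by ring.
rewrite ler_pM2l ?exprn_gt0//.
have : 0 <= `|Y| * sq x by rewrite mulr_ge0// sq_ge0.
lra.
Qed.

Lemma sup_convolution_coercive (C Y : R) x : (forall y, K y -> u y <= C) ->
  (forall y, K y -> sq y <= Y) -> f x <= C + L / 2 * Y - L / 4 * sq x.
Proof.
move=> KC KY; have [Ka -> _] := uf x.
have := sqD_le (x - arg x) (arg x); rewrite subrK => a1.
have := KC _ Ka; have := KY _ Ka => a2 a3.
have : L * sq x <= L * (2 * sq (x - arg x) + 2 * Y) by rewrite ler_pM2l//; lra.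
lra.
Qed.

(** Moving [x] and [arg x] by the same vector leaves the penalization unchanged, so
that [u] inherits at [arg x] the superjets of [f] at [x]. *)
Lemma sup_convolution_jet Omega x p A : open Omega -> Omega `<=` K ->
  touch f x p A -> Omega (arg x) ->
  \forall h \near (0 : 'rV[R]_n),
    u (arg x + h) <= u (arg x) + dotv p h + 2^-1 * quadv A h.
Proof.
move=> oO OK [_ [r r0 H]] Ox.
have h0 : id @ nbhs (0 : 'rV[R]_n) --> (0 : 'rV[R]_n) by exact: cvg_id.
have n1 : \forall h \near (0 : 'rV[R]_n), Omega (arg x + h).
  have : (fun h => arg x + h) @ nbhs (0 : 'rV[R]_n) --> arg x.
    by rewrite -[X in _ --> X]addr0; apply: cvgD => //; exact: cvg_cst.
  by apply; exact: open_nbhs_nbhs.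
have n2 : \forall h \near (0 : 'rV[R]_n), sq h <= r.
  have : (fun h => sq h) @ nbhs (0 : 'rV[R]_n) --> (0 : R).
    by rewrite -(@sq0 R n); exact: cvg_sq.
  by move=> /cvgr_le; apply.
apply: filterS2 n1 n2 => h hO hr.
have [_ fx _] := uf x; have [_ _ /(_ _ (OK _ hO))] := uf (x + h).
have := H _ hr; rewrite fx.
have -> : x + h - (arg x + h) = x - arg x by rewrite opprD addrACA subrr addr0.
lra.
Qed.

End Properties.

(** Heine's theorem, along an ultrafilter. *)
Lemma uniform_continuity K (u : 'rV[R]_n -> R) (e : R) : compact K ->
  {within K, continuous u} -> 0 < e ->
  exists2 d, 0 < d & forall y z, K y -> K z -> sq (y - z) <= d -> `|u y - u z| < e.
Proof.
move=> cK cu e0; apply: contrapT => no.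
have [U [UU Uoo]] := ultraFilterLemma eventually_filter.
have /choice[yz Hyz] : forall k : nat, exists yz : 'rV[R]_n * 'rV[R]_n,
    [/\ K yz.1, K yz.2, sq (yz.1 - yz.2) <= k.+1%:R^-1 & e <= `|u yz.1 - u yz.2|].
  move=> k; apply: contrapT => none; apply: no.
  exists k.+1%:R^-1; first by rewrite invr_gt0.
  move=> y z Ky Kz yz; rewrite ltNge; apply/negP => le.
  by apply: none; exists (y, z).
have [y Ky yy] : exists2 y, K y & (fun k => (yz k).1) @ U --> y.
  by apply: (compact_ultralimit _ _ _ cK); apply: filterE => k; case: (Hyz k).
have d0 : (fun k => (yz k).1 - (yz k).2) @ U --> (0 : 'rV[R]_n).
  apply: cvg_sq0; apply: (@squeeze_cvgr _ _ _ _ (fun=> 0) (fun k => k.+1%:R^-1)).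
  - by apply: filterE => k; rewrite sq_ge0; case: (Hyz k).
  - exact: cvg_cst.
  - by apply: cvg_ultrafilter => //; exact: cvg_harmonic.
have zy : (fun k => (yz k).2) @ U --> y.
  have -> : (fun k => (yz k).2) = (fun k => (yz k).1 - ((yz k).1 - (yz k).2)).
    by apply/funext => k; rewrite opprB addrC subrK.
  by rewrite -[y]subr0; exact: cvgB.
have uy : (fun k => u (yz k).1) @ U --> u y.
  by apply: (within_cvg _ K) => //; apply: filterE => k; case: (Hyz k).
have uz : (fun k => u (yz k).2) @ U --> u y.
  by apply: (within_cvg _ K) => //; apply: filterE => k; case: (Hyz k).
have : e <= `|u y - u y|.
  apply: (@ler_cvg_to _ U _ _ (fun=> e) (fun k => `|u (yz k).1 - u (yz k).2|)).
  - exact: cvg_cst.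
  - by apply: cvg_norm; exact: cvgB.
  - by apply: filterE => k; case: (Hyz k).
by rewrite subrr normr0 leNgt e0.
Qed.

(** By [sup_convolution_coercive] each affine perturbation of the sum of the two
sup-convolutions is maximal somewhere in a fixed ball. *)
Lemma contact_exists (L C Y : R) K u v f g argf argg : 0 < L ->
  sup_convolution L K u f argf -> sup_convolution L K v g argg ->
  (forall y, K y -> u y <= C) -> (forall y, K y -> v y <= C) ->
  (forall y, K y -> sq y <= Y) ->
  exists2 D, 0 < D & forall q, `|q| <= 1 -> exists2 x, `|x| <= D & contact f g x q.
Proof.
move=> L0 uf vg uC vC KY.
have cf := sup_convolution_continuous _ _ _ _ _ L0 uf _ KY.
have cg := sup_convolution_continuous _ _ _ _ _ L0 vg _ KY.
have qn q : `|q| <= 1 -> sq q <= n%:R.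
  move=> q1; apply: (le_trans (sq_le_norm q)).
  by rewrite ler_piMr// expr_le1.
pose c := 2 * C + L * Y + 2 * n%:R / L - (f 0 + g 0).
pose r := `|8 * c / L|.
have r0 : 0 <= r by exact: normr_ge0.
have far q x : `|q| <= 1 -> r < sq x -> f x + g x - dotv q x <= f 0 + g 0.
  move=> q1 rx.
  have := sup_convolution_coercive _ _ _ _ _ L0 uf C Y x uC KY.
  have := sup_convolution_coercive _ _ _ _ _ L0 vg C Y x vC KY.
  have L4 : 0 < 4 / L by rewrite divr_gt0.
  have := dotv_young _ (- q) x L4; rewrite sqN dotvNl invf_div.
  have : 4 / L * sq q <= 4 / L * n%:R by rewrite ler_pM2l// qn.
  have : 8 * c / L <= sq x by apply: le_trans (ler_norm _) (ltW rx).
  rewrite ler_pdivrMr// /c.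
  have -> : 4 / L * n%:R = 2 * (2 * n%:R / L) by ring.
  have : 0 <= L * sq x by rewrite mulr_ge0 ?sq_ge0// ltW.
  set N := 2 * n%:R / L; lra.
exists (r + 1) => [|q q1]; first lra.
have ch : continuous (fun x => f x + g x - dotv q x).
  move=> x; have FF : Filter (nbhs x) := nbhs_filter x.
  apply: cvgB; first by apply: cvgD; [exact: cf|exact: cg].
  by apply: cvg_dotv; [exact: cvg_cst|exact: cvg_id].
have b0 : [set x : 'rV[R]_n | sq x <= r] !=set0 by exists 0; rewrite /= sq0.
have [x] := compact_EVT_max b0 (compact_sq_ball r) (continuous_subspaceT ch).
rewrite inE /= => xr Hmax; exists x.
  have := norm_sq_le x; set t := `|x| => tx.
  by have := sqr_ge0 (t - 2^-1); rewrite sqrrB; lra.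
move=> y; rewrite !dotvE.
have H0 : f 0 + g 0 <= f x + g x - dotv q x.
  by have := Hmax 0; rewrite inE /= sq0 dotv0r subr0; apply.
have [yr|yr] := leP (sq y) r; last by have := far q y q1 yr; lra.
by have := Hmax y; rewrite inE /= => /(_ yr); lra.
Qed.

End SupConvolution.

(** * Limiting jets and comparison *)

Section Comparison.
Context {R : realType} {n : nat}.
Implicit Types (f g u v : 'rV[R]_n -> R) (p q x y z h w e : 'rV[R]_n) (A B : 'M[R]_n)
  (K Omega : set 'rV[R]_n).

Lemma littleo_cst0 : (fun=> 0 : R) =o_ (0 : 'rV[R]_n) (fun z => dotv z z).
Proof.
by apply/eqoP => e e0; apply: filterE => z; rewrite normr0 mulr_ge0// ltW.
Qed.

Lemma superjet_intro u y p A : symm A ->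
  (\forall h \near (0 : 'rV[R]_n),
    u (y + h) <= u y + dotv p h + 2^-1 * quadv A h) -> superjet u y (p, A).
Proof.
move=> sA H; split => //; exists (fun=> 0); first exact: littleo_cst0.
by apply: filterS H => h; rewrite addr0.
Qed.

Lemma subjet_intro u y p A : symm A ->
  (\forall h \near (0 : 'rV[R]_n),
    - u (y + h) <= - u y + dotv p h + 2^-1 * quadv A h) ->
  subjet u y (- p, - A).
Proof.
move=> sA H; split; first exact: symmN.
exists (fun=> 0); first exact: littleo_cst0.
by apply: filterS H => h; rewrite /= addr0 dotvNl quadvNl; lra.
Qed.

Lemma compact_closure_bounded Omega : bounded_set Omega -> compact (closure Omega).
Proof.
move=> [M [Mr HM]]; apply: bounded_closed_compact; last exact: closed_closure.
exists (M + 1); split => [|N MN x cx /=]; first by rewrite realD.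
apply: le_trans (ltW MN); move: x cx.
suff : closure Omega `<=` [set y | `|y| <= M + 1] by apply.
rewrite closureE; apply: smallest_sub; last first.
  by move=> y Oy; apply: (HM (M + 1)) => //; rewrite ltrDl.
apply: (@preimage_closed _ _ (fun y : 'rV[R]_n => `|y|) [set t | t <= M + 1]); last exact: closed_le.
by move=> y _; exact: norm_continuous.
Qed.

Lemma operator_cvg (F : R -> 'rV[R]_n -> 'M[R]_n -> R) {T : Type}
    (G : set_system T) {FG : Filter G} (r_ : T -> R) (p_ : T -> 'rV[R]_n)
    (A_ : T -> 'M[R]_n) r p A :
  continuous_operator F -> symm A -> (forall k, symm (A_ k)) ->
  r_ @ G --> r -> p_ @ G --> p -> A_ @ G --> A ->
  F (r_ k) (p_ k) (A_ k) @[k --> G] --> F r p A.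
Proof.
move=> /subspace_continuousP cF sA sA_ rr pp AA B BF.
have := cF (r, p, A) sA B BF; rewrite /within /= => H.
have : (fun k => (r_ k, p_ k, A_ k)) @ G --> (r, p, A).
  exact: (cvg_pair (cvg_pair rr pp) AA).
by move=> /(_ _ H) H2; apply: (@filterS _ G FG _ _ _ H2) => k /=; apply; exact: sA_.
Qed.

(** The theorem on sums for sup-convolutions of [u] and [v]. At a maximum point [x] of
[f + g] the slopes are opposite, and the approximate touching paraboloids
provided by [contact_touching] converge: their slopes are determined by the
maximizers, and their matrices are bounded by semiconvexity together with the
bound on the sum. The jets are recorded as limits since the equation holds only at
the approximating points [argf (x1 k)] and [argg (x2 k)] of [u] and [v]. *)
Theorem limiting_jets (L : R) K u v f g argf argg : 0 < L -> compact K ->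
  K !=set0 -> {within K, continuous u} -> {within K, continuous v} ->
  sup_convolution L K u f argf -> sup_convolution L K v g argg ->
  exists (G : set_system nat) x y z p A B
    (x1 x2 p1 p2 : nat -> 'rV[R]_n) (A_ B_ : nat -> 'M[R]_n),
  [/\ ProperFilter G, contact f g x 0 & forall h, quadv A h + quadv B h <= 0] /\
  [/\ K y, f x = u y - L / 2 * sq (x - y), (argf \o x1) @ G --> y,
      p1 @ G --> p & A_ @ G --> A] /\
  [/\ K z, g x = v z - L / 2 * sq (x - z), (argg \o x2) @ G --> z,
      p2 @ G --> - p & B_ @ G --> B] /\
  forall k, touch f (x1 k) (p1 k) (A_ k) /\ touch g (x2 k) (p2 k) (B_ k).
Proof.
move=> L0 cK K0 cu cv uf vg.
have [yu _ uC] := compact_EVT_max K0 cK cu.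
have [yv _ vC] := compact_EVT_max K0 cK cv.
have csq : {within K, continuous (sq : 'rV[R]_n -> R)}.
  apply: continuous_subspaceT => y; have FF : Filter (nbhs y) := nbhs_filter y.
  by apply: cvg_sq; exact: cvg_id.
have [ys _ HY] := compact_EVT_max K0 cK csq.
pose C := Num.max (u yu) (v yv).
have {}uC y : K y -> u y <= C by move=> Ky; rewrite le_max uC// inE.
have {}vC y : K y -> v y <= C by move=> Ky; rewrite le_max vC ?orbT// inE.
have {HY} HY y : K y -> sq y <= sq ys by move=> Ky; apply: HY; rewrite inE.
have [D D0 HD] := contact_exists L C _ K u v f g _ _ L0 uf vg uC vC HY.
have cf := sup_convolution_continuous _ _ _ _ _ L0 uf _ HY.
have cg := sup_convolution_continuous _ _ _ _ _ L0 vg _ HY.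
have bf := sup_convolution_slope_below _ _ _ _ _ uf.
have bg := sup_convolution_slope_below _ _ _ _ _ vg.
have k0 k : (0 : R) < k.+1%:R^-1 by rewrite invr_gt0.
pose P (k : nat) (x q x1 p1 : 'rV[R]_n) A x2 p2 B :=
    [/\ `|x| <= D, `|q| <= k.+1%:R^-1 & contact f g x q] /\
    [/\ `|x1 - x| <= k.+1%:R^-1, `|x2 - x| <= k.+1%:R^-1,
        touch f x1 p1 A, touch g x2 p2 B &
      forall h, quadv A h + quadv B h <= k.+1%:R^-1 * sq h].
have /choice[t Ht] : forall k : nat, exists t : ('rV[R]_n * 'rV[R]_n) *
    ('rV[R]_n * 'rV[R]_n * 'M[R]_n) * ('rV[R]_n * 'rV[R]_n * 'M[R]_n),
    P k t.1.1.1 t.1.1.2 t.1.2.1.1 t.1.2.1.2 t.1.2.2 t.2.1.1 t.2.1.2 t.2.2.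
  move=> k.
  have [x [q [x1 [p1 [A [x2 [p2 [B H]]]]]]]] := contact_touching L L0 f g D
    k.+1%:R^-1 D0 (k0 k) cf cg (fun z => ex_intro _ _ (bf z))
    (fun z => ex_intro _ _ (bg z)) HD.
  by exists (x, q, (x1, p1, A), (x2, p2, B)).
pose x_ k := (t k).1.1.1; pose q_ k := (t k).1.1.2.
pose x1 k := (t k).1.2.1.1; pose p1 k := (t k).1.2.1.2; pose A_ k := (t k).1.2.2.
pose x2 k := (t k).2.1.1; pose p2 k := (t k).2.1.2; pose B_ k := (t k).2.2.
have {}Ht k : P k (x_ k) (q_ k) (x1 k) (p1 k) (A_ k) (x2 k) (p2 k) (B_ k) := Ht k.
move: x_ q_ x1 p1 A_ x2 p2 B_ Ht => x_ q_ x1 p1 A_ x2 p2 B_ Ht {t}.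
have [G [UG Goo]] := ultraFilterLemma eventually_filter.
have small (y_ : nat -> 'rV[R]_n) : (forall k, `|y_ k| <= k.+1%:R^-1) ->
    y_ @ G --> (0 : 'rV[R]_n).
  move=> H; apply: norm_cvg0; apply: (@squeeze_cvgr _ _ _ _ (fun=> 0) (fun k => k.+1%:R^-1)).
  - by apply: filterE => k; rewrite normr_ge0 H.
  - exact: cvg_cst.
  - by apply: cvg_ultrafilter => //; exact: cvg_harmonic.
have [x xx] : exists x : 'rV[R]_n, x_ @ G --> x.
  apply: (bounded_ultralimit_sq _ _ (n%:R * D ^+ 2)); apply: filterE => k.
  have [[xD _ _] _] := Ht k; apply: (le_trans (sq_le_norm _)).
  by apply: ler_wpM2l => //; rewrite lerXn2r ?nnegrE// ltW.
have near_x (y_ : nat -> 'rV[R]_n) : (forall k, `|y_ k - x_ k| <= k.+1%:R^-1) ->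
    y_ @ G --> x.
  move=> /small y0; rewrite -[x]add0r.
  have -> : y_ = (fun k => (y_ k - x_ k) + x_ k) by apply/funext => k; rewrite subrK.
  exact: cvgD.
have x1x : x1 @ G --> x by apply: near_x => k; case: (Ht k) => _ [].
have x2x : x2 @ G --> x by apply: near_x => k; case: (Ht k) => _ [].
have q0 : q_ @ G --> (0 : 'rV[R]_n) by apply: small => k; case: (Ht k) => [[]].
have xmax : contact f g x 0.
  move=> y; apply: (@ler_cvg_to _ G _ _ (fun=> f y + g y)
    (fun k => f (x_ k) + g (x_ k) + dotv (q_ k) (y - x_ k))).
  - exact: cvg_cst.
  - apply: cvgD; last by apply: cvg_dotv => //; apply: cvgB => //; exact: cvg_cst.
    by apply: cvgD; [exact: (@continuous_cvg _ _ _ _ _ _ f _ (cf _) xx)|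
      exact: (@continuous_cvg _ _ _ _ _ _ g _ (cg _) xx)].
  - by apply: filterE => k; case: (Ht k) => [[_ _ H] _]; exact: H.
have limit_arg (a b : 'rV[R]_n -> R) (arg : 'rV[R]_n -> 'rV[R]_n) (y_ : nat -> 'rV[R]_n) :
    {within K, continuous a} -> continuous b -> sup_convolution L K a b arg ->
    y_ @ G --> x -> exists y, [/\ K y, b x = a y - L / 2 * sq (x - y) &
      (arg \o y_) @ G --> y].
  move=> ca cb ab yx.
  have Karg k : K ((arg \o y_) k) by case: (ab (y_ k)).
  have [y Ky yy] : exists2 y, K y & (arg \o y_) @ G --> y.
    by apply: (compact_ultralimit _ _ _ cK); exact: filterE.
  exists y; split => //.
  apply: (@cvg_unique _ (@Rhausdorff R) (fmap (b \o y_) G)).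
    exact: (@continuous_cvg _ _ _ _ _ _ b _ (cb _) yx).
  have -> : b \o y_ = (fun k => a (arg (y_ k)) - L / 2 * sq (y_ k - arg (y_ k))).
    by apply/funext => k /=; case: (ab (y_ k)).
  apply: cvgB; first by apply: (within_cvg _ K) => //; exact: filterE.
  apply: cvgM; first exact: cvg_cst.
  by apply: cvg_sq; exact: cvgB.
have [y [Ky fy y1]] := limit_arg _ _ _ _ cu cf uf x1x.
have [z [Kz gz z2]] := limit_arg _ _ _ _ cv cg vg x2x.
have slope_arg (a b : 'rV[R]_n -> R) (arg : 'rV[R]_n -> 'rV[R]_n) (y_ p_ : nat -> 'rV[R]_n)
    (X_ : nat -> 'M[R]_n) w :
    sup_convolution L K a b arg -> (forall k, touch b (y_ k) (p_ k) (X_ k)) ->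
    y_ @ G --> x -> (arg \o y_) @ G --> w -> p_ @ G --> L *: (w - x).
  move=> ab H yx yw.
  have -> : p_ = (fun k => L *: ((arg \o y_) k - y_ k)).
    apply/funext => k; apply/esym.
    exact: (touch_slope _ _ _ _ _ _ (sup_convolution_slope_below _ _ _ _ _ ab _) (H k)).
  by apply: cvgZr; exact: cvgB.
have tf k : touch f (x1 k) (p1 k) (A_ k) by case: (Ht k) => _ [].
have tg k : touch g (x2 k) (p2 k) (B_ k) by case: (Ht k) => _ [].
have pp1 := slope_arg _ _ _ _ _ _ _ uf tf x1x y1.
have pp2 := slope_arg _ _ _ _ _ _ _ vg tg x2x z2.
have [p0 _] := contact_split _ _ _ _ _ _ _
  (maximizer_slope_below _ _ _ _ _ uf _ _ Ky fy)
  (maximizer_slope_below _ _ _ _ _ vg _ _ Kz gz) xmax.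
have lA k := touch_matrix_ge _ _ _ _ _ _ (bf (x1 k)) (tf k).
have lB k := touch_matrix_ge _ _ _ _ _ _ (bg (x2 k)) (tg k).
have uAB k h : quadv (A_ k) h + quadv (B_ k) h <= sq h.
  case: (Ht k) => _ [_ _ _ _ /(_ h)] /le_trans; apply.
  by rewrite ler_piMl ?sq_ge0// invf_le1// ler1n.
have [A AA] : exists A : 'M[R]_n, A_ @ G --> A.
  apply: (bounded_ultralimit_mx _ _ _ (3 * (L + 1))); apply: filterE => k.
  apply: entry_bound; [by case: (tf k)|by rewrite addr_ge0// ltW|move=> h].
  have := lA k h; have := lB k h; have := uAB k h; have := sq_ge0 h.
  by rewrite ler_norml => *; apply/andP; split; lra.
have [B BB] : exists B : 'M[R]_n, B_ @ G --> B.
  apply: (bounded_ultralimit_mx _ _ _ (3 * (L + 1))); apply: filterE => k.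
  apply: entry_bound; [by case: (tg k)|by rewrite addr_ge0// ltW|move=> h].
  have := lA k h; have := lB k h; have := uAB k h; have := sq_ge0 h.
  by rewrite ler_norml => *; apply/andP; split; lra.
exists G, x, y, z, (L *: (y - x)), A, B, x1, x2, p1, p2, A_, B_.
split; last split; last split; last by move=> k; split.
- split; [exact: ultra_proper|exact: xmax|move=> h].
  apply: (@ler_cvg_to _ G _ _ (fun k => quadv (A_ k) h + quadv (B_ k) h)
    (fun k => k.+1%:R^-1 * sq h)).
  + by apply: cvgD; apply: cvg_quadv => //; exact: cvg_cst.
  + rewrite -(mul0r (sq h)); apply: cvgM; last exact: cvg_cst.
    by apply: cvg_ultrafilter => //; exact: cvg_harmonic.
  + by apply: filterE => k; case: (Ht k) => _ [].
- by split.
- split=> //; move/eqP : p0; rewrite addr_eq0 => /eqP ->.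
  by rewrite opprK.
Qed.

End Comparison.

(** With [M = u x0 - v x0 > 0], the sum of the sup-convolutions [fu] of [u] and [fv] of [- v] is
at least [M] at [x0], hence at its maximum point [x]; so [u y - v z] is at least [M] at
the maximizers [y] and [z] for [x]. The constant [L] is chosen so that their squared
distance is at most [d], below which the oscillations of [u] and [v] are less than [M] and
that of [f] is less than [gamma * M]. On the boundary [u] and [v] agree, so [y] and [z]
are in [Omega], and the equation at the limiting jets bounds [gamma * M] by [f z - f y]. *)
Lemma viscosity_comparison (R : realType) (n : nat) (Omega : set 'rV[R]_n)
    (F : R -> 'rV[R]_n -> 'M[R]_n -> R) (f b : 'rV[R]_n -> R) (gamma : R) :
  open Omega -> bounded_set Omega -> continuous_operator F ->
  {within closure Omega, continuous f} -> 0 < gamma ->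
  (forall r p X Y, symm X -> symm Y -> le_symm X Y -> F r p X <= F r p Y) ->
  (forall r s p X, symm X -> r <= s -> F r p X >= F s p X + gamma * (s - r)) ->
  forall u v, viscosity_solution Omega F f b u ->
    viscosity_solution Omega F f b v ->
  forall x, closure Omega x -> u x <= v x.
Proof.
move=> oO bO cF cf gamma0 Fell Fprop u v [cu ub usub _] [cv vb _ vsup] x0 Kx0.
rewrite leNgt; apply/negP => vu; set K := closure Omega in cu cv cf Kx0 *.
pose M := u x0 - v x0; have M0 : 0 < M by rewrite subr_gt0.
have OK : Omega `<=` K by exact: subset_closure.
have cK : compact K by exact: compact_closure_bounded.
have K0 : K !=set0 by exists x0.
have cNv : {within K, continuous (fun y => - v y)}.
  apply/subspace_continuousP => y Ky; apply: cvgN.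
  by move/subspace_continuousP : cv; exact.
have [yu _ uC] := compact_EVT_max K0 cK cu.
have [yv _ vC] := compact_EVT_max K0 cK cNv.
pose C := `|u yu| + `|- v yv|.
have uvC y z : K y -> K z -> u y - v z <= C.
  move=> Ky Kz; rewrite lerD//; apply: le_trans (ler_norm _).
    by apply: uC; rewrite inE.
  by apply: vC; rewrite inE.
have [d1 d10 Hu] := uniform_continuity K u M cK cu M0.
have [d2 d20 Hv] := uniform_continuity K v M cK cv M0.
have gM0 : 0 < gamma * M by rewrite mulr_gt0.
have [d3 d30 Hf] := uniform_continuity K f (gamma * M) cK cf gM0.
pose d := Num.min d1 (Num.min d2 d3).
have d0 : 0 < d by rewrite !lt_min d10 d20.
have C0 : 0 <= C by rewrite addr_ge0.
pose L := 4 * C / d + 1.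
have Ld : L * d = 4 * C + d by rewrite /L; field; rewrite gt_eqF.
have L0 : 0 < L by rewrite ltr_wpDl// divr_ge0 ?mulr_ge0// ltW.
have [fu [argu Hsu]] := sup_convolution_exists L K u K0 cK cu.
have [fv [argv Hsv]] := sup_convolution_exists L K _ K0 cK cNv.
have [G [x [y [z [p [A [B [x1 [x2 [p1 [p2 [A_ [B_ H]]]]]]]]]]]]] :=
  limiting_jets L K u (fun y => - v y) fu fv argu argv L0 cK K0 cu cNv Hsu Hsv.
case: H => [[PG xmax AB] [[Ky fy yy pp AA] [[Kz gz zz qq BB] Ht]]].
have uv : M + L / 2 * (sq (x - y) + sq (x - z)) <= u y - v z.
  have := xmax x0; rewrite dotv0l addr0 fy gz.
  have [_ _ /(_ x0 Kx0)] := Hsu x0; have [_ _ /(_ x0 Kx0)] := Hsv x0.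
  by rewrite subrr sq0 mulr0 /M; lra.
have yz : sq (y - z) <= d.
  have := sqD_le (y - x) (x - z); rewrite addrA subrK (sqBC y x) => a1.
  have := uvC _ _ Ky Kz => a2.
  rewrite -(ler_pM2l L0) Ld.
  have : L * sq (y - z) <= L * (2 * sq (x - y) + 2 * sq (x - z)) by rewrite ler_pM2l.
  lra.
have ss : 0 <= L / 2 * (sq (x - y) + sq (x - z)).
  by rewrite mulr_ge0 ?addr_ge0 ?sq_ge0// divr_ge0// ltW.
have uvM : M <= u y - v z by lra.
have inO (w : 'rV[R]_n) : K w -> ~ Omega w -> u w = v w.
  move=> Kw nOw; have bw : (closure Omega `\` Omega°) w.
    by split=> // /interior_subset.
  by rewrite ub// vb.
have Oy : Omega y.
  apply: contrapT => nO; have := Hv y z Ky Kz.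
  rewrite -(inO y Ky nO) => Hyz.
  have /Hyz : sq (y - z) <= d2 by apply: (le_trans yz); rewrite !ge_min lexx orbT.
  by rewrite ltr_norml => /andP[_]; lra.
have Oz : Omega z.
  apply: contrapT => nO; have := Hu y z Ky Kz.
  rewrite (inO z Kz nO) => Hyz.
  have /Hyz : sq (y - z) <= d1 by apply: (le_trans yz); rewrite !ge_min lexx.
  by rewrite ltr_norml => /andP[_]; lra.
have fyz : `|f y - f z| < gamma * M.
  by apply: Hf => //; apply: (le_trans yz); rewrite !ge_min lexx !orbT.
have sA_ k : symm (A_ k) by case: (Ht k) => -[].
have sB_ k : symm (B_ k) by case: (Ht k) => _ [].
have sA : symm A by exact: (symm_limit G A_).
have sB : symm B by exact: (symm_limit G B_).
have nOy : \forall k \near G, Omega (argu (x1 k)).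
  by apply: yy; exact: open_nbhs_nbhs.
have nOz : \forall k \near G, Omega (argv (x2 k)).
  by apply: zz; exact: open_nbhs_nbhs.
have Karg1 k : K (argu (x1 k)) by case: (Hsu (x1 k)).
have Karg2 k : K (argv (x2 k)) by case: (Hsv (x2 k)).
have FAp : f y <= F (u y) p A.
  apply: (@ler_cvg_to _ G _ _ (fun k => f (argu (x1 k)))
    (fun k => F (u (argu (x1 k))) (p1 k) (A_ k))).
  - by apply: (within_cvg _ K) => //; exact: filterE.
  - by apply: operator_cvg => //; apply: (within_cvg _ K) => //; exact: filterE.
  - apply: filterS nOy => k Ok; apply: usub => //; apply: superjet_intro => //.
    exact: (sup_convolution_jet _ _ _ _ _ Hsu _ _ _ _ oO OK (Ht k).1 Ok).
have FBp : F (v z) p (- B) <= f z.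
  rewrite -[p]opprK.
  apply: (@ler_cvg_to _ G _ _ (fun k => F (v (argv (x2 k))) (- p2 k) (- B_ k))
    (fun k => f (argv (x2 k)))).
  - apply: operator_cvg => //; first exact: symmN.
    + by move=> k; exact: symmN.
    + by apply: (within_cvg _ K) => //; exact: filterE.
    + exact: cvgN.
    + exact: cvgN.
  - by apply: (within_cvg _ K) => //; exact: filterE.
  - apply: filterS nOz => k Ok; apply: vsup => //; apply: subjet_intro => //.
    exact: (sup_convolution_jet _ _ _ _ _ Hsv _ _ _ _ oO OK (Ht k).2 Ok).
have := Fell (v z) p A (- B) sA (symmN _ sB) _.
have := Fprop (v z) (u y) p A sA ltac:(lra).
have : gamma * M <= gamma * (u y - v z) by rewrite ler_pM2l.
move=> a1 a2 a3.
have : F (v z) p A <= F (v z) p (- B).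
  by apply: a3; apply/le_symmP => h; rewrite quadvNl; have := AB h; lra.
by move: fyz; rewrite ltr_norml => /andP[? ?]; lra.
Qed.

Theorem theorem2 (R : realType) (n : nat) (Omega : set 'rV[R]_n)
    (F : R -> 'rV[R]_n -> 'M[R]_n -> R) (f b : 'rV[R]_n -> R) (gamma : R)
    (Omega_open : open Omega) (Omega_bounded : bounded_set Omega)
    (F_cont : continuous_operator F)
    (f_cont : {within closure Omega, continuous f})
    (b_cont : {within closure Omega, continuous b})
    (gamma_gt0 : 0 < gamma)
    (F_elliptic : forall (r : R) (p : 'rV[R]_n) (X Y : 'M[R]_n),
       symm X -> symm Y -> le_symm X Y -> F r p X <= F r p Y)
    (F_proper : forall (r s : R) (p : 'rV[R]_n) (X : 'M[R]_n),
       symm X -> r <= s -> F r p X >= F s p X + gamma * (s - r)) :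
  forall u v : 'rV[R]_n -> R,
    viscosity_solution Omega F f b u ->
    viscosity_solution Omega F f b v ->
    forall x, closure Omega x -> u x = v x.
Proof.
move=> u v su sv x Kx; apply/eqP; rewrite eq_le; apply/andP; split.
- exact: (viscosity_comparison _ _ Omega F f b gamma).
- exact: (viscosity_comparison _ _ Omega F f b gamma).
Qed.
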